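(* Let $E$ be a complex Banach space, $A$ a closed linear operator on $E$, and $C\in L(E)$ injective with $CA\subset AC$. Let $K\in L^1_{loc}([0,\infty))$ be not identically zero and suppose there is $\beta\in\mathbb R$ such that $\tilde K(\lambda)=\int_0^\infty e^{-\lambda t}K(t)\,dt$ exists for all $\lambda\in\mathbb C$ with $\operatorname{Re}\lambda>\beta$. (a) Assume that $A$ is a subgenerator of an exponentially bounded, $K$-convoluted $C$-cosine function $(C_K(t))_{t\ge0}$ with $\|C_K(t)\|\le Me^{\omega t}$, $t\ge0$, for some $M>0$ and $\omega\ge0$. Put $\omega_1=\max(\omega,\beta)$. Then $$\{\lambda^2:\ \operatorname{Re}\lambda>\omega_1,\ \tilde K(\lambda)\ne0\}\subset\rho_C(A)\qquad(1)$$ and $$\lambda(\lambda^2-A)^{-1}Cx=\frac1{\tilde K(\lambda)}\int_0^\infty e^{-\lambda t}C_K(t)x\,dt,\quad x\in E,\ \operatorname{Re}\lambda>\omega_1,\ \tilde K(\lambda)\ne0.\qquad(2)$$ (b) Suppose that $(C_K(t))_{t\ge0}\subset L(E)$ is a strongly continuous operator family satisfying $\|C_K(t)\|\le Me^{\omega t}$, $t\ge0$, for some $M>0$ and $\omega\ge0$. Put $\omega_1=\max(\omega,\beta)$. If (1) and (2) hold, then $(C_K(t))_{t\ge0}$ is an exponentially bounded, $K$-convoluted $C$-cosine function with a subgenerator $A$.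
   Context: $\rho_C(A)=\{\lambda\in\mathbb C: R(C)\subset R(\lambda-A)\text{ and }\lambda-A\text{ is injective}\}$. With $\Theta(t)=\int_0^tK(s)ds$, $A$ is a subgenerator of a $K$-convoluted $C$-cosine function $(C_K(t))_{t\ge0}$ if $(C_K(t))_{t\ge0}\subset L(E)$ is a strongly continuous operator family such that $C_K(t)A\subset AC_K(t)$, $C_K(t)C=CC_K(t)$, and for all $x\in E$, $t\ge0$: $\int_0^t(t-s)C_K(s)x\,ds\in D(A)$ and $A\int_0^t(t-s)C_K(s)x\,ds=C_K(t)x-\Theta(t)Cx$. It is exponentially bounded if $\|C_K(t)\|\le Me^{\omega t}$, $t\ge0$, for some $M>0$, $\omega\in\mathbb R$. *)

(* Defs.v *)
(* The scalar field is R[i], the complex numbers over R : realType. *)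
From HB Require Import structures.
From mathcomp Require Export all_boot all_order all_algebra.
From mathcomp Require Export all_classical all_reals all_analysis.
From mathcomp Require Export complex.
Export Order.TTheory GRing.Theory Num.Theory.
Export numFieldNormedType.Exports.

Set Implicit Arguments.
Unset Strict Implicit.
Unset Printing Implicit Defensive.

Local Open Scope classical_set_scope.
Local Open Scope complex_scope.
Local Open Scope ring_scope.

Definition cexp (R : realType) (z : R[i]) : R[i] :=
  (expR (complex.Re z) * cos (complex.Im z))
    +i* (expR (complex.Re z) * sin (complex.Im z)).

Definition cintegral (R : realType) (D : set R) (f : R -> R[i]) : R[i] :=
  (\int[@lebesgue_measure R]_(s in D) complex.Re (f s))
    +i* (\int[@lebesgue_measure R]_(s in D) complex.Im (f s)).

(* L^1_loc([0, +oo[): integrability up to and including the endpoint 0; the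
   values of K on the negative half-line are irrelevant. *)
Definition L1loc (R : realType) (K : R -> R[i]) : Prop :=
  forall b : R, 0 <= b ->
    (@lebesgue_measure R).-integrable `[0, b]
      (fun s => (complex.Re (K s))%:E) /\
    (@lebesgue_measure R).-integrable `[0, b]
      (fun s => (complex.Im (K s))%:E).

(* "K = 0" in L^1_loc([0, +oo[) is equality almost everywhere. *)
Definition L1loc_zero (R : realType) (K : R -> R[i]) : Prop :=
  {ae @lebesgue_measure R, forall t, 0 <= t -> K t = 0}.

(* The scalar Laplace integral is improper at +oo: it may converge only
   conditionally. R[i]^o is R[i] with its usual topology. *)
Definition laplace_partial (R : realType) (K : R -> R[i]) (lambda : R[i])
    (b : R) : R[i]^o :=
  cintegral `[0, b] (fun t => cexp (- (lambda * t%:C)) * K t).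

Definition laplace_ex (R : realType) (K : R -> R[i]) (lambda : R[i]) : Prop :=
  cvg (laplace_partial K lambda b @[b --> +oo%R]).

Definition laplace (R : realType) (K : R -> R[i]) (lambda : R[i]) : R[i] :=
  lim (laplace_partial K lambda b @[b --> +oo%R]).

(* v is the Riemann integral of f over [a, b], a <= b: the Riemann sums of
   tagged partitions a < p_0 < ... < p_(n-1) = b converge to v with the mesh.
   All E-valued integrands below are continuous, so this agrees with the
   Bochner integral. *)
Definition is_RInt (R : realType) (E : completeNormedModType R[i])
    (f : R -> E) (a b : R) (v : E) : Prop :=
  forall e : R, 0 < e -> exists2 d : R, 0 < d &
    forall (p : seq R) (xi : nat -> R), itv_partition a b p ->
      (forall i, (i < size p)%N ->
         nth b p i - nth b (a :: p) i < d /\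
         nth b (a :: p) i <= xi i <= nth b p i) ->
      `| \sum_(i < size p) (nth b p i - nth b (a :: p) i)%:C *: f (xi i) - v |
        < e%:C.

Definition is_RInt_oo (R : realType) (E : completeNormedModType R[i])
    (f : R -> E) (v : E) : Prop :=
  exists F : R -> E, (forall b, 0 <= b -> is_RInt f 0 b (F b)) /\
    F b @[b --> +oo%R] --> v.

(* The norm of E takes (nonnegative real) values in R[i]. *)
Definition opnorm (R : realType) (E : completeNormedModType R[i])
    (T : E -> E) : R :=
  sup [set complex.Re `|T x| | x in [set x : E | `|x| <= 1]].

(* A linear operator on E with domain a linear subspace; only the values of
   [op] on [dom] are meaningful. *)
Record linop (R : realType) (E : completeNormedModType R[i]) := LinOp {
  dom : set E;
  op :> E -> E;
  dom_0 : dom 0;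
  dom_linear : forall (a : R[i]) x y, dom x -> dom y -> dom (a *: x + y);
  op_linear : forall (a : R[i]) x y, dom x -> dom y ->
    op (a *: x + y) = a *: op x + op y
}.

Definition closed_linop (R : realType) (E : completeNormedModType R[i])
    (A : linop E) : Prop :=
  closed [set p : E * E | dom A p.1 /\ p.2 = A p.1].

(* T A `<=` A T for an everywhere defined T: dom (T A) = dom A, whereas
   dom (A T) = T @^-1` dom A. *)
Definition commutes_into (R : realType) (E : completeNormedModType R[i])
    (T : E -> E) (A : linop E) : Prop :=
  forall x, dom A x -> dom A (T x) /\ T (A x) = A (T x).

Definition lambda_sub (R : realType) (E : completeNormedModType R[i])
    (A : linop E) (lambda : R[i]) (x : E) : E := lambda *: x - A x.

Definition rhoC (R : realType) (E : completeNormedModType R[i])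
    (C : E -> E) (A : linop E) : set R[i] :=
  [set lambda | range C `<=` lambda_sub A lambda @` dom A /\
     set_inj (dom A) (lambda_sub A lambda)].

(* (lambda - A)^-1 y, with the junk value 0 when y is not in the range of
   lambda - A. *)
Definition lambda_sub_inv (R : realType) (E : completeNormedModType R[i])
    (A : linop E) (lambda : R[i]) (y : E) : E :=
  xget 0 [set x | dom A x /\ lambda_sub A lambda x = y].

(* Operator families indexed by [0, +oo[; values at t < 0 are irrelevant. *)
Definition strongly_continuous_family (R : realType)
    (E : completeNormedModType R[i]) (S : R -> {linear E -> E}) : Prop :=
  (forall t, 0 <= t -> continuous (S t)) /\
  (forall x, {within `[0, +oo[, continuous (fun t => S t x)}).

Definition exp_bound (R : realType) (E : completeNormedModType R[i])
    (S : R -> {linear E -> E}) (M omega : R) : Prop :=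
  forall t, 0 <= t -> opnorm (S t) <= M * expR (omega * t).

Definition exponentially_bounded (R : realType)
    (E : completeNormedModType R[i]) (S : R -> {linear E -> E}) : Prop :=
  exists M omega : R, 0 < M /\ exp_bound S M omega.

Definition Theta (R : realType) (K : R -> R[i]) (t : R) : R[i] :=
  cintegral `[0, t] K.

Definition subgenerator_of_convoluted_cosine (R : realType)
    (E : completeNormedModType R[i]) (K : R -> R[i]) (C : {linear E -> E})
    (A : linop E) (CK : R -> {linear E -> E}) : Prop :=
  [/\ strongly_continuous_family CK,
      forall t, 0 <= t -> commutes_into (CK t) A,
      forall t, 0 <= t -> forall x, CK t (C x) = C (CK t x) &
      forall x t, 0 <= t -> exists v,
        [/\ is_RInt (fun s => (t - s)%:C *: CK s x) 0 t v,
            dom A v & A v = CK t x - Theta K t *: C x]].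

Definition resolvent_inclusion (R : realType)
    (E : completeNormedModType R[i]) (K : R -> R[i]) (C : {linear E -> E})
    (A : linop E) (omega1 : R) : Prop :=
  [set lambda ^+ 2 | lambda in
     [set lambda : R[i] | omega1 < complex.Re lambda /\
                          laplace K lambda != 0]] `<=` rhoC C A.

(* The equality includes the convergence of the improper integral v. *)
Definition resolvent_formula (R : realType)
    (E : completeNormedModType R[i]) (K : R -> R[i]) (C : {linear E -> E})
    (A : linop E) (CK : R -> {linear E -> E}) (omega1 : R) : Prop :=
  forall (x : E) (lambda : R[i]),
    omega1 < complex.Re lambda -> laplace K lambda != 0 ->
    exists v : E,
      is_RInt_oo (fun t => cexp (- (lambda * t%:C)) *: CK t x) v /\
      lambda *: lambda_sub_inv A (lambda ^+ 2) (C x) =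
        (laplace K lambda)^-1 *: v.

(* Main.v *)
Require Import Defs.
From mathcomp Require Import ring lra measurable_realfun.

(* A continuous E-valued function f on [0, oo[ has a primitive S0, and S0 has a
   primitive S, so that int_0^t (t - s) C_K(s)x ds = S(t) for f = C_K(.)x.
   Partial integration turns the transform v of C_K(.)x into v / l^2 for S, and
   that of Theta is K~(l) / l; so, A being closed, the identity
   A S(t) = C_K(t)x - Theta(t)Cx gives A(v / l^2) = v - (K~(l) / l) Cx, which is
   (a). For (b), all three properties say that a pair of functions takes its
   values in a closed linear relation (the graph of A or of C), and the
   resolvent formula gives this for the pairs of transforms at every real l with
   K~(l) <> 0. Those l are dense, as a transform that vanishes on an interval
   vanishes further on, hence comes from the function 0. The relation passes to
   the functions by the inversion formula
   int_0^t f = lim_n int_0^oo (1 - (1 - exp(-ls))^n) f(s) ds, exp(lt) = n,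
   whose right-hand side involves only the transforms at l, 2l, ..., nl. *)

Set Implicit Arguments.
Unset Strict Implicit.
Unset Printing Implicit Defensive.

Local Open Scope classical_set_scope.
Local Open Scope complex_scope.
Local Open Scope ring_scope.

(** * Real-valued norms and linear identities *)

(** Two obstacles shape the argument: (2) says nothing at the zeros of K~, and the transform of K
    may converge only conditionally. Both are met on the real axis, without analytic functions. For
    the second, everything is moved to Theta: it is continuous, and convergence of K~ at one k > 0
    already bounds it by a multiple of exp(kt), so that its own transform converges absolutely to
    the right of k. For the first, transforms are continuous from the right at real points, and a
    zero of K~ has nonzeros of K~ arbitrarily close on its right. Relations are used instead of
    operators because A is unbounded: A f can be transformed only if f takes values in D(A), which
    is the claim, whereas relating f to a candidate g for A f presupposes nothing. The inversion
    respects a closed linear relation, since it consists of finite linear combinations and limits.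
    It returns int_0^t f, and difference quotients lead back to f. In (a), injectivity of l^2 - A
    needs an extra argument: if A z = l^2 z, then A C_K(t)z = l^2 C_K(t)z as well, and the two
    resulting values of A at the transform of C_K(.)z differ by a nonzero multiple of Cz. *)

Section RealNorm.
Context (R : realType) (E : normedModType R[i]).
Implicit Types (x y z : E).

Definition nrm x : R := complex.Re `|x|.

Lemma nrmE x : `|x| = (nrm x)%:C.
Proof. by rewrite /nrm RRe_real// ger0_real. Qed.

Lemma nrm_ge0 x : 0 <= nrm x.
Proof. by rewrite -ler0c -nrmE. Qed.

Lemma nrm0 : nrm 0 = 0.
Proof. by rewrite /nrm normr0. Qed.

Lemma nrm_eq0 x : nrm x = 0 -> x = 0.
Proof. by move=> x0; apply/normr0_eq0; rewrite nrmE x0. Qed.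

Lemma nrmD x y : nrm (x + y) <= nrm x + nrm y.
Proof. by rewrite -lecR rmorphD/= -!nrmE ler_normD. Qed.

Lemma nrmN x : nrm (- x) = nrm x.
Proof. by rewrite /nrm normrN. Qed.

Lemma nrmBC x y : nrm (x - y) = nrm (y - x).
Proof. by rewrite -nrmN opprB. Qed.

Lemma nrmB x y : nrm (x - y) <= nrm x + nrm y.
Proof. by rewrite -(nrmN y) nrmD. Qed.

Lemma nrm_tri y x z : nrm (x - z) <= nrm (x - y) + nrm (y - z).
Proof. by rewrite -[x in leLHS](subrK y) -addrA nrmD. Qed.

Lemma nrm_le_small x : (forall e : R, 0 < e -> nrm x <= e) -> x = 0.
Proof.
move=> h; apply: nrm_eq0; apply/eqP; rewrite eq_le nrm_ge0 andbT.
by apply/ler_addgt0Pr => e e0; rewrite add0r h.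
Qed.

End RealNorm.

Section RealNormScale.
Context (R : realType) (E : normedModType R[i]).
Implicit Types (x y : E) (z : R[i]).

Lemma nrmZ z x : nrm (z *: x) = nrm (z : R[i]^o) * nrm x.
Proof. by apply/complexI; rewrite rmorphM/= -!nrmE normrZ. Qed.

Lemma nrm_real (r : R) : nrm (r%:C : R[i]^o) = `|r|.
Proof. by rewrite /nrm normc_def/= expr0n addr0 sqrtr_sqr. Qed.

Lemma nrmZr (r : R) x : nrm (r%:C *: x) = `|r| * nrm x.
Proof. by rewrite nrmZ nrm_real. Qed.

Lemma nrmZr_ge0 (r : R) x : 0 <= r -> nrm (r%:C *: x) = r * nrm x.
Proof. by move=> r0; rewrite nrmZr ger0_norm. Qed.

Lemma Re_le_nrm z : `|complex.Re z| <= nrm (z : R[i]^o).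
Proof. by rewrite -lecR -nrmE; exact: normc_ge_Re. Qed.

Lemma nrm_le_ReIm z : nrm (z : R[i]^o) <= `|complex.Re z| + `|complex.Im z|.
Proof.
rewrite /nrm normc_def/= -[leRHS]ger0_norm ?addr_ge0// -sqrtr_sqr ler_wsqrtr//.
by rewrite sqrrD !real_normK ?num_real// lerD2r lerDl mulrn_wge0// mulr_ge0.
Qed.

End RealNormScale.

Lemma nrmM (R : realType) (z w : R[i]) :
  nrm (z * w : R[i]^o) = nrm (z : R[i]^o) * nrm (w : R[i]^o).
Proof. exact: (@nrmZ R R[i]^o z w). Qed.

Section Primitive.
Context (R : realType).

(** Passage from short intervals to long ones: cut [a, b] into n equal pieces shorter than d and
    chain them. It stands in for compactness arguments and for inductions over partitions. *)
Lemma itv_chain_ind (Q : R -> R -> Prop) (a b d : R) :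
  (forall s t, a <= s -> s <= t -> t <= b -> t - s < d -> Q s t) ->
  (forall s t u, a <= s -> s <= t -> t <= u -> u <= b ->
     Q s t -> Q t u -> Q s u) ->
  0 < d -> a <= b -> Q a b.
Proof.
move=> Qd Qtrans d0 ab.
have [n nd] : exists n : nat, (b - a) / d < n%:R.
  exists (Num.bound ((b - a) / d)).
  by rewrite archi_boundP// divr_ge0 ?subr_ge0// ltW.
have n0 : (0 : R) < n%:R by apply: le_lt_trans nd; rewrite divr_ge0 ?subr_ge0// ltW.
pose p k : R := a + k%:R * ((b - a) / n%:R).
have pS k : p k.+1 - p k = (b - a) / n%:R by rewrite /p -natr1; ring.
have hd : (b - a) / n%:R < d.
  by rewrite ltr_pdivrMr// mulrC -ltr_pdivrMr.
have h0 : 0 <= (b - a) / n%:R by rewrite divr_ge0 ?subr_ge0// ltW.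
have pb k : (k <= n)%N -> p k <= b.
  move=> kn; rewrite /p -lerBrDl mulrCA -[leRHS]mulr1 ler_wpM2l ?subr_ge0//.
  by rewrite ler_pdivrMr// mul1r ler_nat.
have ap k : a <= p k by rewrite /p lerDl mulr_ge0.
have ppS k : p k <= p k.+1 by rewrite -subr_ge0 pS.
have -> : b = p n by rewrite /p mulrC divfK ?gt_eqF// addrC subrK.
have p0 : p 0%N = a by rewrite /p mul0r addr0.
have {n0 nd}: (n <= n)%N by [].
elim: {-2}n => [_|k IH kn].
  by rewrite p0; apply: Qd; rewrite ?subrr.
apply: (Qtrans a (p k)) => //; [exact: pb|exact/IH/ltnW|].
by apply: Qd; rewrite ?pS//; exact: pb.
Qed.

End Primitive.

(** Formal linear combinations of numbered atoms. Equal coefficients imply equal values, so an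
    identity in a module is reduced to scalar identities for [ring] or [field]. *)
Inductive vexpr (K : Type) :=
| VAtom of nat | VZero | VAdd of vexpr K & vexpr K | VOpp of vexpr K
| VScale of K & vexpr K.
Arguments VAtom {K} _.
Arguments VZero {K}.

Fixpoint veval (K : pzRingType) (V : lmodType K) (s : seq V) (e : vexpr K) : V :=
  match e with
  | VAtom n => nth 0 s n
  | VZero => 0
  | VAdd e1 e2 => veval s e1 + veval s e2
  | VOpp e1 => - veval s e1
  | VScale a e1 => a *: veval s e1
  end.

(** [eqn] rather than [==] lets [cbn] decide whether two concrete indices agree. *)
Fixpoint vcoef (K : pzRingType) (e : vexpr K) (n : nat) : K :=
  match e with
  | VAtom m => if eqn m n then 1 else 0
  | VZero => 0
  | VAdd e1 e2 => vcoef e1 n + vcoef e2 n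
  | VOpp e1 => - vcoef e1 n
  | VScale a e1 => a * vcoef e1 n
  end.

Fixpoint vcoefs_eq (K : pzRingType) (n : nat) (e1 e2 : vexpr K) : Prop :=
  if n is n'.+1 then vcoef e1 n' = vcoef e2 n' /\ vcoefs_eq n' e1 e2 else True.

Lemma vevalE (K : pzRingType) (V : lmodType K) (s : seq V) (e : vexpr K) :
  veval s e = \sum_(i < size s) vcoef e i *: s`_i.
Proof.
elim: e => /= [n||e1 -> e2 ->|e1 ->|a e1 ->].
- under eq_bigr do rewrite -[eqn _ _]/(n == _ :> nat).
  have [ns|sn] := ltnP n (size s); last first.
    rewrite nth_default// big1// => i _.
    by rewrite gtn_eqF ?scale0r// (leq_trans (ltn_ord i)).
  rewrite (bigD1 (Ordinal ns))//= eqxx scale1r big1 ?addr0// => i ni.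
  by rewrite ifN ?scale0r// eq_sym; apply: contra ni => /eqP ni; exact/eqP/val_inj.
- by rewrite big1// => i _; rewrite scale0r.
- by rewrite -big_split/=; apply: eq_bigr => i _; rewrite scalerDl.
- by rewrite -sumrN; apply: eq_bigr => i _; rewrite scaleNr.
- by rewrite scaler_sumr; apply: eq_bigr => i _; rewrite scalerA.
Qed.

Lemma veval_eq (K : pzRingType) (V : lmodType K) (s : seq V) (e1 e2 : vexpr K) :
  vcoefs_eq (size s) e1 e2 -> veval s e1 = veval s e2.
Proof.
rewrite !vevalE => h; apply: eq_bigr => i _; congr (_ *: _).
have: forall n, vcoefs_eq n e1 e2 -> forall k, (k < n)%N -> vcoef e1 k = vcoef e2 k.
  elim=> [//|n IH] [e H] k; rewrite ltnS leq_eqVlt => /predU1P[->//|]; exact: IH.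
by move/(_ _ h); apply.
Qed.

Ltac vindex x l :=
  match l with
  | x :: _ => constr:(0%N)
  | _ :: ?l' => let n := vindex x l' in constr:(S n)
  end.

Ltac vreify K l t :=
  match t with
  | (?a + ?b)%R => let a' := vreify K l a in let b' := vreify K l b in
                   constr:(@VAdd K a' b')
  | (- ?a)%R => let a' := vreify K l a in constr:(@VOpp K a')
  | (?k *: ?a)%R => let a' := vreify K l a in constr:(@VScale K k a')
  | 0%R => constr:(@VZero K)
  | _ => let n := vindex t l in constr:(@VAtom K n)
  end.

(* Reduces a linear identity between the vectors listed in [l] to the
   identities between their coefficients. *)
Ltac vector_identity K l :=
  match goal with |- ?x = ?y =>
    let x' := vreify K l x in let y' := vreify K l y in
    let H := fresh in
    have H := @veval_eq K _ l x' y'; cbn [veval nth] in H; apply: H;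
    cbn [vcoefs_eq vcoef size eqn]; do ?split
  end.

(** * Primitives of vector-valued functions *)

(* The derivative is taken uniformly on bounded intervals: this gives the
   convergence of the Riemann sums at once, with no mean value theorem. *)
Definition is_prim (R : realType) (E : normedModType R[i]) (f F : R -> E) : Prop :=
  forall b e : R, 0 <= b -> 0 < e -> exists2 d : R, 0 < d &
    forall s x t, 0 <= s -> s <= x -> x <= t -> t <= b -> t - s < d ->
      nrm (F t - F s - (t - s)%:C *: f x) <= e * (t - s).

(** Like [is_prim], this never looks at negative arguments, where the operator families are
    arbitrary. *)
Definition ucont (R : realType) (E : normedModType R[i]) (f : R -> E) : Prop :=
  forall b e : R, 0 <= b -> 0 < e -> exists2 d : R, 0 < d &
    forall s t, 0 <= s -> s <= t -> t <= b -> t - s < d ->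
      nrm (f t - f s) <= e.

Section PrimitiveTheory.
Context (R : realType) (E : normedModType R[i]).
Implicit Types (f g F G : R -> E).

Lemma eq_prim f g F G : (forall t, 0 <= t -> f t = g t) ->
  (forall t, 0 <= t -> F t = G t) -> is_prim f F -> is_prim g G.
Proof.
move=> fg FG fF b e b0 e0; have [d d0 h] := fF b e b0 e0.
exists d => // s x t s0 sx xt tb ts.
have x0 := le_trans s0 sx; have t0 := le_trans x0 xt.
by rewrite -!FG// -fg//; exact: h.
Qed.

Lemma prim_lin (a : R[i]) f g F G : is_prim f F -> is_prim g G ->
  is_prim (fun t => a *: f t + g t) (fun t => a *: F t + G t).
Proof.
move=> fF gG b e b0 e0.
pose k := nrm (a : R[i]^o) + 1.
have k0 : 0 < k by rewrite ltr_wpDl// nrm_ge0.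
have [d d0 h] := fF b (e / 2 / k) b0 (divr_gt0 (divr_gt0 e0 (ltr0n _ 2)) k0).
have [d' d'0 h'] := gG b (e / 2) b0 (divr_gt0 e0 (ltr0n _ 2)).
exists (Num.min d d'); first by rewrite lt_min d0.
move=> s x t s0 sx xt tb; rewrite lt_min => /andP[ts ts'].
have -> : a *: F t + G t - (a *: F s + G s) - (t - s)%:C *: (a *: f x + g x) =
    a *: (F t - F s - (t - s)%:C *: f x) + (G t - G s - (t - s)%:C *: g x).
  by vector_identity (R[i]) [:: F t; F s; f x; G t; G s; g x]; ring.
apply: (le_trans (nrmD _ _)); rewrite nrmZ.
have {}h := h s x t s0 sx xt tb ts; have {}h' := h' s x t s0 sx xt tb ts'.
rewrite [e]splitr mulrDl lerD//.
apply: (@le_trans _ _ (k * (e / 2 / k * (t - s)))).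
  by apply: ler_pM => //; rewrite ?nrm_ge0// lerDl.
by rewrite mulrA [k * _]mulrC divfK// gt_eqF.
Qed.

Lemma prim_cst (c : E) : is_prim (fun=> 0) (fun=> c).
Proof.
move=> b e b0 e0; exists 1 => // s x t s0 sx xt tb ts.
by rewrite subrr scaler0 subrr nrm0 mulr_ge0 ?(ltW e0)// subr_ge0 (le_trans sx).
Qed.

Lemma primD f g F G : is_prim f F -> is_prim g G ->
  is_prim (fun t => f t + g t) (fun t => F t + G t).
Proof.
move=> fF gG; have := prim_lin 1 fF gG.
by apply: eq_prim => t _; rewrite scale1r.
Qed.

Lemma primZ (a : R[i]) f F : is_prim f F ->
  is_prim (fun t => a *: f t) (fun t => a *: F t).
Proof.
move=> fF; have := prim_lin a fF (prim_cst 0).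
by apply: eq_prim => t _; rewrite addr0.
Qed.

Lemma primB f g F G : is_prim f F -> is_prim g G ->
  is_prim (fun t => f t - g t) (fun t => F t - G t).
Proof.
move=> fF gG; have := prim_lin (-1) gG fF.
by apply: eq_prim => t _; rewrite scaleN1r addrC.
Qed.

(** The tag x in [is_prim] is free in [s, t]: comparing the tags s and t on one interval cancels the
    increment of F and leaves (t - s)(f(t) - f(s)). *)
Lemma prim_ucont f F : is_prim f F -> ucont f.
Proof.
move=> fF b e b0 e0.
have [d d0 h] := fF b (e / 2) b0 (divr_gt0 e0 (ltr0n _ 2)).
exists d => // s t s0; rewrite le_eqVlt => /predU1P[->|st] tb ts.
  by rewrite subrr nrm0 ltW.
have ts0 : 0 < t - s by rewrite subr_gt0.
rewrite -(ler_pM2l ts0) -nrmZr_ge0 ?(ltW ts0)// scalerBr.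
have hs := h s s t s0 (lexx _) (ltW st) tb ts.
have ht := h s t t s0 (ltW st) (lexx _) tb ts.
have -> : (t - s)%:C *: f t - (t - s)%:C *: f s =
  (F t - F s - (t - s)%:C *: f s) - (F t - F s - (t - s)%:C *: f t).
  by vector_identity (R[i]) [:: f t; f s; F t; F s]; ring.
by rewrite (le_trans (nrmB _ _))// [e]splitr mulrC mulrDl lerD.
Qed.

Lemma eq_ucont f g : (forall t, 0 <= t -> f t = g t) -> ucont f -> ucont g.
Proof.
move=> fg cf b e b0 e0; have [d d0 h] := cf b e b0 e0.
exists d => // s t s0 st tb ts.
by rewrite -!fg ?(le_trans s0)//; exact: h.
Qed.

Lemma ucont_bounded f b : ucont f -> 0 <= b ->
  exists2 M : R, 0 < M & forall t, 0 <= t -> t <= b -> nrm (f t) <= M.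
Proof.
move=> cf b0; have [d d0 h] := cf b 1 b0 ltr01.
suff [M M0 hM] : exists2 M : R, 0 < M & forall t, 0 <= t -> t <= b -> nrm (f t) <= M.
  by exists M.
apply: (@itv_chain_ind R (fun s u => exists2 M : R, 0 < M & forall t, s <= t -> t <= u ->
  nrm (f t) <= M) 0 b d) => //.
- move=> s t s0 st tb ts; exists (nrm (f s) + 1).
    by rewrite ltr_wpDl// nrm_ge0.
  move=> u su ut; have := h s u s0 su (le_trans ut tb) (le_lt_trans (lerB ut (lexx _)) ts).
  by move=> hu; rewrite -[f u](subrK (f s)) (le_trans (nrmD _ _))// [leRHS]addrC lerD.
- move=> s t u s0 st tu ub [M M0 h1] [M' M'0 h2]; exists (M + M'); first exact: addr_gt0.
  move=> v sv vu; have [vt|tv] := leP v t.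
    by rewrite (le_trans (h1 _ _ _))// lerDl ltW.
  by rewrite (le_trans (h2 _ (ltW tv) _))// lerDr ltW.
Qed.

Lemma prim_prim_ucont f F : is_prim f F -> ucont F.
Proof.
move=> fF b e b0 e0; have [M M0 hM] := ucont_bounded (prim_ucont fF) b0.
have [d d0 h] := fF b M b0 M0.
have M20 : 0 < M + M by rewrite addr_gt0.
exists (Num.min d (e / (M + M))); first by rewrite lt_min d0 divr_gt0.
move=> s t s0 st tb; rewrite lt_min => /andP[ts ts'].
have h1 := h s s t s0 (lexx _) st tb ts.
rewrite -[F t - F s](subrK ((t - s)%:C *: f s)).
rewrite (le_trans (nrmD _ _))// (@le_trans _ _ ((M + M) * (t - s)))//.
  rewrite mulrDl lerD// nrmZr_ge0 ?subr_ge0// mulrC ler_wpM2r ?subr_ge0// hM//.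
  exact: le_trans tb.
by rewrite mulrC -ler_pdivlMr// ltW.
Qed.

Lemma ucont_lin (a : R[i]) f g : ucont f -> ucont g -> ucont (fun t => a *: f t + g t).
Proof.
move=> cf cg b e b0 e0.
pose k := nrm (a : R[i]^o) + 1.
have k0 : 0 < k by rewrite ltr_wpDl// nrm_ge0.
have [d d0 h] := cf b (e / 2 / k) b0 (divr_gt0 (divr_gt0 e0 (ltr0n _ 2)) k0).
have [d' d'0 h'] := cg b (e / 2) b0 (divr_gt0 e0 (ltr0n _ 2)).
exists (Num.min d d'); first by rewrite lt_min d0.
move=> s t s0 st tb; rewrite lt_min => /andP[ts ts'].
rewrite opprD addrACA -scalerBr.
apply: (le_trans (nrmD _ _)); rewrite nrmZ [e]splitr lerD//; last exact: h'.
apply: (@le_trans _ _ (k * (e / 2 / k))).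
  by apply: ler_pM => //; rewrite ?nrm_ge0 ?lerDl//; exact: h.
by rewrite mulrC divfK// gt_eqF.
Qed.

Lemma ucont_cst (c : E) : ucont (fun=> c).
Proof. by move=> b e b0 e0; exists 1 => // *; rewrite subrr nrm0 ltW. Qed.

Lemma ucontB f g : ucont f -> ucont g -> ucont (fun t => f t - g t).
Proof.
move=> cf cg; have := ucont_lin (-1) cg cf.
by apply: eq_ucont => t _; rewrite scaleN1r addrC.
Qed.

End PrimitiveTheory.

Section PrimitiveScale.
Context (R : realType) (E : normedModType R[i]).
Implicit Types (f F : R -> E) (p q : R -> R[i]^o).

Lemma ucont_scale p f : ucont p -> ucont f ->
  ucont (fun t => p t *: f t).
Proof.
move=> cp cf b e b0 e0.
have [M M0 hM] := ucont_bounded cf b0.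
have [N N0 hN] := ucont_bounded cp b0.
have [d d0 h] := cp b (e / 2 / M) b0 (divr_gt0 (divr_gt0 e0 (ltr0n _ 2)) M0).
have [d' d'0 h'] := cf b (e / 2 / N) b0 (divr_gt0 (divr_gt0 e0 (ltr0n _ 2)) N0).
exists (Num.min d d'); first by rewrite lt_min d0.
move=> s t s0 st tb; rewrite lt_min => /andP[ts ts'].
have -> : p t *: f t - p s *: f s = (p t - p s) *: f t + p s *: (f t - f s).
  by rewrite scalerBl scalerBr addrA subrK.
rewrite (le_trans (nrmD _ _))// !nrmZ [e]splitr lerD//.
- rewrite -[leRHS](@divfK _ M) ?gt_eqF// ler_pM ?nrm_ge0 ?h ?hM//.
  exact: le_trans st.
- rewrite -[leRHS](@divfK _ N) ?gt_eqF// mulrC ler_pM ?nrm_ge0 ?h' ?hN//.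
  exact: le_trans tb.
Qed.

Lemma prim_scale p q f F : is_prim q p -> is_prim f F ->
  is_prim (fun t => q t *: F t + p t *: f t) (fun t => p t *: F t).
Proof.
move=> qp fF b e b0 e0.
have cq := prim_ucont qp; have cp := prim_prim_ucont qp.
have cf := prim_ucont fF; have cF := prim_prim_ucont fF.
have [M [M0 Mq Mp Mf MF]] : exists M : R, [/\ 0 < M,
    forall t, 0 <= t -> t <= b -> nrm (q t) <= M,
    forall t, 0 <= t -> t <= b -> nrm (p t) <= M,
    forall t, 0 <= t -> t <= b -> nrm (f t) <= M &
    forall t, 0 <= t -> t <= b -> nrm (F t) <= M].
  have [M1 M10 h1] := ucont_bounded cq b0; have [M2 M20 h2] := ucont_bounded cp b0.
  have [M3 M30 h3] := ucont_bounded cf b0; have [M4 M40 h4] := ucont_bounded cF b0.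
  exists (M1 + M2 + M3 + M4); split => [|t t0 tb|t t0 tb|t t0 tb|t t0 tb].
  - by rewrite !addr_gt0.
  - have := h1 t t0 tb; lra.
  - have := h2 t t0 tb; lra.
  - have := h3 t t0 tb; lra.
  - have := h4 t t0 tb; lra.
pose k := e / 4 / M.
have k0 : 0 < k by rewrite !divr_gt0.
have kM : k * M = e / 4 by rewrite divfK// gt_eqF.
have [d1 d10 h1] := qp b k b0 k0; have [d2 d20 h2] := cp b k b0 k0.
have [d3 d30 h3] := fF b k b0 k0; have [d4 d40 h4] := cF b k b0 k0.
exists (Num.min (Num.min d1 d2) (Num.min d3 d4)); first by rewrite !lt_min d10 d20 d30.
move=> s x t s0 sx xt tb; rewrite !lt_min => /andP[/andP[td1 td2] /andP[td3 td4]].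
have st := le_trans sx xt; have ts0 : 0 <= t - s by rewrite subr_ge0.
have x0 := le_trans s0 sx; have xb := le_trans xt tb.
have t0 := le_trans x0 xt; have sb := le_trans st tb.
(* Four errors of size e / 4 each: the remainders of p and of F, and the cost of moving F from x to
   t and p from x to s. *)
have -> : p t *: F t - p s *: F s - (t - s)%:C *: (q x *: F x + p x *: f x) =
  (p t - p s - (t - s)%:C * q x) *: F t + p s *: (F t - F s - (t - s)%:C *: f x)
  + (t - s)%:C *: (q x *: (F t - F x)) - (t - s)%:C *: ((p x - p s) *: f x).
  by vector_identity (R[i]) [:: F t; F s; F x; f x]; ring.
have b1 := h1 s x t s0 sx xt tb td1.
have b2 : nrm (p x - p s) <= k by apply: h2 => //; lra.
have b3 := h3 s x t s0 sx xt tb td3.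
have b4 : nrm (F t - F x) <= k by apply: h4 => //; lra.
rewrite (le_trans (nrmB _ _))//.
have -> : e * (t - s) = (k * (t - s)) * M + M * (k * (t - s)) +
   (t - s) * (M * k) + (t - s) * (k * M).
  by rewrite -mulrA [(t - s) * M]mulrC [M * (k * _)]mulrA mulrA [M * k]mulrC kM; field.
rewrite lerD//; last first.
  by rewrite nrmZr_ge0// nrmZ ler_wpM2l// ler_pM ?nrm_ge0// Mf.
rewrite (le_trans (nrmD _ _))// lerD//; last first.
  by rewrite nrmZr_ge0// nrmZ ler_wpM2l// ler_pM ?nrm_ge0// Mq.
rewrite (le_trans (nrmD _ _))// !nrmZ lerD// ler_pM ?nrm_ge0 ?MF ?Mp//.
Qed.

End PrimitiveScale.

(** * Riemann sums of a function with a primitive *)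

Section RiemannIntegral.
Context (R : realType) (E : completeNormedModType R[i]).
Implicit Types (f F : R -> E).

(** Each piece of the partition has an error proportional to its length; the errors add up to k
    times the total length, whatever the number of pieces. *)
Let riemann_sum_err f F (k d b : R) :
  (forall s x t, 0 <= s -> s <= x -> x <= t -> t <= b -> t - s < d ->
     nrm (F t - F s - (t - s)%:C *: f x) <= k * (t - s)) ->
  forall p a xi, 0 <= a -> path <%R a p -> last a p <= b ->
    (forall i, (i < size p)%N -> nth b p i - nth b (a :: p) i < d /\
       nth b (a :: p) i <= xi i <= nth b p i) ->
  nrm (\sum_(i < size p) (nth b p i - nth b (a :: p) i)%:C *: f (xi i)
    - (F (last a p) - F a)) <= k * (last a p - a).
Proof.
move=> h; elim=> [a xi _ _ _ _|y p IH a xi a0 /= /andP[ay yp] lb hp].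
  by rewrite /= big_ord0 !subrr nrm0 mulr0.
have yl : y <= last y p by apply: (@itv_partition_le _ _ y (last y p) p); split.
have y0 : 0 <= y by rewrite (le_trans a0)// ltW.
have := IH y (xi \o succn) y0 yp lb (fun i ip => hp i.+1 ip).
have [/= hd /andP[ax xy]] := hp 0%N isT.
have := h a (xi 0%N) y a0 ax xy (le_trans yl lb) hd.
rewrite big_ord_recl/= => h1 h2.
set S := (\sum_(i < size p) _) in h2; set S' := \sum_(i < size p) _.
have <- : S = S' by apply: eq_bigr.
have -> : (y - a)%:C *: f (xi 0%N) + S - (F (last y p) - F a) =
  (S - (F (last y p) - F y)) - (F y - F a - (y - a)%:C *: f (xi 0%N)).
  by vector_identity (R[i]) [:: f (xi 0%N); S; F (last y p); F a; F y]; ring.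
rewrite (le_trans (nrmB _ _))//; lra.
Qed.

Lemma prim_is_RInt f F (a b : R) : 0 <= a -> a <= b -> is_prim f F ->
  is_RInt f a b (F b - F a).
Proof.
move=> a0 ab fF e e0.
(* The added 1 covers a = b and makes the final inequality strict. *)
have k0 : 0 < b - a + 1 by rewrite ltr_wpDl// subr_ge0.
have [d d0 h] := fF b (e / (b - a + 1)) (le_trans a0 ab) (divr_gt0 e0 k0).
exists d => // p xi [ap /eqP lp] hp.
have lb : last a p <= b by rewrite lp.
have := riemann_sum_err h a0 ap lb hp; rewrite lp => H.
rewrite nrmE ltcR (le_lt_trans H)// mulrAC ltr_pdivrMr// ltr_pM2l//; lra.
Qed.

(** Ensures that [is_RInt] is not vacuous: one partition fine enough for two candidate integrals
    shows that they agree. *)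
Lemma fine_partition (a b d : R) : a <= b -> 0 < d ->
  exists p, itv_partition a b p /\
    forall i, (i < size p)%N -> nth b p i - nth b (a :: p) i < d.
Proof.
move=> ab d0.
suff [p pp lp] : exists2 p, path (fun x y => (x < y) && (y - x < d)) a p & last a p = b.
  exists p; split; last by move=> i ip; move/(pathP b): pp => /(_ i ip)/andP[].
  split; last exact/eqP.
  by apply: sub_path pp => x y /andP[].
apply: (@itv_chain_ind R (fun s t => exists2 p,
  path (fun x y => (x < y) && (y - x < d)) s p & last s p = t) a b d) => //.
- move=> s t _; rewrite le_eqVlt => /predU1P[->|st] tb ts; first by exists [::].
  by exists [:: t] => //=; rewrite st ts.
- move=> s t u _ _ _ _ [p sp <-] [q tq <-]; exists (p ++ q).
    by rewrite cat_path sp.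
  by rewrite last_cat.
Qed.

Lemma is_RInt_unique f (a b : R) v w : a <= b ->
  is_RInt f a b v -> is_RInt f a b w -> v = w.
Proof.
move=> ab hv hw; apply/eqP; rewrite -subr_eq0; apply/eqP.
apply: nrm_le_small => e e0.
have e20 : 0 < e / 2 by rewrite divr_gt0.
have [d d0 h] := hv _ e20; have [d' d'0 h'] := hw _ e20.
have [|p [pp mp]] := @fine_partition a b (Num.min d d') ab; first by rewrite lt_min d0.
have md : Num.min d d' <= d by rewrite ge_min lexx.
have md' : Num.min d d' <= d' by rewrite ge_min lexx orbT.
have pth i : (i < size p)%N -> nth b (a :: p) i <= nth b p i <= nth b p i.
  by case: pp => /(pathP b) + _ ip => /(_ i ip)/ltW ->; rewrite lexx.
have {}h := h p (nth b p) pp (fun i ip => conj (lt_le_trans (mp i ip) md) (pth i ip)).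
have {}h' := h' p (nth b p) pp (fun i ip => conj (lt_le_trans (mp i ip) md') (pth i ip)).
move: h h'; set S := \sum_(i < _) _; rewrite !nrmE !ltcR => h h'.
have -> : v - w = (S - w) - (S - v) by vector_identity (R[i]) [:: v; w; S]; ring.
rewrite (le_trans (nrmB _ _))//; lra.
Qed.

End RiemannIntegral.

(** * Mean value inequalities *)

Section PrimitiveBounds.
Context (R : realType) (E : normedModType R[i]).
Implicit Types (f F : R -> E).

(** G need not be differentiated: it suffices that on every piece G grows at least as fast as g
    prescribes at some point x, because x can then serve as the tag in the estimate for F. *)
Lemma prim_bound f F (g G : R -> R) (a b : R) : 0 <= a -> a <= b -> is_prim f F ->
  (forall t, a <= t -> t <= b -> nrm (f t) <= g t) ->
  (forall s t, a <= s -> s <= t -> t <= b ->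
     exists x, [/\ s <= x, x <= t & g x * (t - s) <= G t - G s]) ->
  nrm (F b - F a) <= G b - G a.
Proof.
move=> a0 ab fF fg gG; apply/ler_addgt0Pr => e e0.
have k0 : 0 < b - a + 1 by rewrite ltr_wpDl// subr_ge0.
have [d d0 h] := fF b (e / (b - a + 1)) (le_trans a0 ab) (divr_gt0 e0 k0).
set k := e / (b - a + 1) in h.
have H : nrm (F b - F a) <= G b - G a + k * (b - a).
  apply: (@itv_chain_ind R (fun s t => nrm (F t - F s) <= G t - G s + k * (t - s)) a b d) => //.
  - move=> s t sa st tb ts; have [x [sx xt gx]] := gG s t sa st tb.
    have := h s x t (le_trans a0 sa) sx xt tb ts.
    have := fg x (le_trans sa sx) (le_trans xt tb) => h1 h2.
    rewrite -[F t - F s](subrK ((t - s)%:C *: f x)) (le_trans (nrmD _ _))//.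
    rewrite addrC lerD// nrmZr_ge0 ?subr_ge0//.
    by rewrite (le_trans _ gx)// mulrC ler_wpM2r// subr_ge0.
  - move=> s t u _ _ _ _ h1 h2; rewrite (le_trans (nrm_tri (F t) _ _))//; lra.
rewrite (le_trans H)// lerD2l /k mulrAC ler_pdivrMr// ler_pM2l//; lra.
Qed.

Lemma exp_bound_ge0 f (c k : R) :
  (forall s, 0 <= s -> nrm (f s) <= c * expR (k * s)) -> 0 <= c.
Proof.
move=> /(_ 0 (lexx _)) /(le_trans (nrm_ge0 _)).
by rewrite pmulr_lge0// expR_gt0.
Qed.

Lemma prim_bound_expR f F (c k a b : R) : 0 <= a -> a <= b -> k != 0 -> is_prim f F ->
  (forall t, a <= t -> t <= b -> nrm (f t) <= c * expR (k * t)) ->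
  nrm (F b - F a) <= c / k * (expR (k * b) - expR (k * a)).
Proof.
move=> a0 ab k0 fF fg; rewrite mulrBr.
have c0 : 0 <= c.
  have := le_trans (nrm_ge0 _) (fg a (lexx _) ab).
  by rewrite pmulr_lge0// expR_gt0.
apply: (@prim_bound f F (fun t => c * expR (k * t)) (fun t => c / k * expR (k * t))) => //.
move=> s t sa st tb.
have expS (x y : R) : expR (k * x) - expR (k * y) >= expR (k * y) * (k * (x - y)).
  have -> : k * x = k * y + k * (x - y) by ring.
  rewrite expRD -[X in _ <= _ - X]mulr1 -mulrBr ler_wpM2l ?expR_ge0//.
  by rewrite lerBrDl expR_ge1Dx.
(* A convex function lies above its tangents. The tag must be the endpoint at which the exponential
   is smaller: the right one for k < 0, the left one for k > 0. *)
move: k0; rewrite neq_lt => /orP[k0|k0].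
  exists t; split => //.
  rewrite /= -mulrBr -!mulrA ler_wpM2l// ler_ndivlMl//.
  by have := expS s t; lra.
exists s; split => //.
rewrite /= -mulrBr -!mulrA ler_wpM2l// ler_pdivlMl//.
by have := expS t s; lra.
Qed.

End PrimitiveBounds.

(** * Existence of primitives *)

Section Existence.
Context (R : realType) (E : completeNormedModType R[i]).
Implicit Types (f F : R -> E).

Lemma nrm_sum (I : Type) (s : seq I) (P : pred I) (u : I -> E) :
  nrm (\sum_(i <- s | P i) u i) <= \sum_(i <- s | P i) nrm (u i).
Proof.
elim/big_ind2 : _ => [|x a y b ha hb|//]; first by rewrite nrm0.
by rewrite (le_trans (nrmD _ _))// lerD.
Qed.

Lemma nrm_complete (u : nat -> E) :
  (forall e : R, 0 < e -> exists N, forall n m, (N <= n)%N -> (N <= m)%N ->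
     nrm (u n - u m) <= e) ->
  exists l, forall e : R, 0 < e -> exists N, forall n, (N <= n)%N -> nrm (u n - l) <= e.
Proof.
move=> h.
have cu : cvg (u @ \oo).
  apply/cauchy_cvgP/cauchy_exP => e; rewrite ltcE/= => /andP[/eqP Ie e0].
  have [N hN] := h (complex.Re e / 2) (divr_gt0 e0 (ltr0n _ 2)).
  exists (u N); exists N => // n /= Nn.
  rewrite -ball_normE/= nrmE ltcE/= Ie eqxx/=.
  by rewrite (le_lt_trans (hN _ _ _ Nn))// ltr_pdivrMr// mulr_natr mulr2n ltrDl.
exists (lim (u @ \oo)) => e e0.
have /cvgrPdist_le /(_ e%:C) := cu; rewrite (ltcR 0) => /(_ e0)[N _ hN].
exists N => n Nn; have := hN n Nn; rewrite nrmE lecR nrmBC.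
exact.
Qed.

Let node (n k : nat) : R := k%:R / n.+1%:R.
(** Length of the part of the k-th cell to the left of t; its increment from s to t is the length of
    the overlap with [s, t]. *)
Let width n k (t : R) : R := Num.min t (node n k.+1) - Num.min t (node n k).
(* Primitive of the step function with value f(k/(n+1)) on [k/(n+1), (k+1)/(n+1)[. *)
Let step f n t : E := \sum_(k < n.+1 * n.+1) (width n k t)%:C *: f (node n k).

Let widthP n k s t : s <= t ->
  0 <= width n k t - width n k s /\
  (width n k t - width n k s = 0 \/ (node n k < t /\ s < node n k + n.+1%:R^-1)).
Proof.
move=> st; rewrite /width.
have -> : node n k.+1 = node n k + n.+1%:R^-1 by rewrite /node -natr1 mulrDl mul1r.
have : 0 < (n.+1%:R^-1 : R) by rewrite invr_gt0.
move: (node n k) (_^-1) => u h h0.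
rewrite /Num.min; do 4 case: ltP => ?; split; try lra; try (left; lra); right; split; lra.
Qed.

(** The (n + 1)^2 cells of length 1 / (n + 1) reach up to n + 1, hence cover [0, n]. *)
Let sum_width n t : 0 <= t -> t <= n%:R ->
  \sum_(k < n.+1 * n.+1) width n k t = t.
Proof.
move=> t0 tn; rewrite /width -(big_mkord xpredT (fun k =>
  Num.min t (node n k.+1) - Num.min t (node n k))) telescope_sumr//.
rewrite /node mul0r (min_idPr t0) subr0; apply/min_idPl.
by rewrite natrM mulfK ?pnatr_eq0// (le_trans tn)// ler_nat.
Qed.

(** The point is that d does not depend on n, so the estimate survives the limit. Half of the
    modulus of continuity pays for t - s and half for the cell length, which places every node that
    contributes within that modulus of x. *)
Let step_approx f (b e : R) : ucont f -> 0 <= b -> 0 < e ->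
  exists N, exists2 d : R, 0 < d & forall n, (N <= n)%N ->
    forall s x t, 0 <= s -> s <= x -> x <= t -> t <= b -> t - s < d ->
    nrm (step f n t - step f n s - (t - s)%:C *: f x) <= e * (t - s).
Proof.
move=> cf b0 e0; have [d d0 h] := cf b e b0 e0.
pose N := maxn (Num.bound b) (Num.bound (2 / d)).
exists N; exists (d / 2); first by rewrite divr_gt0.
move=> n; rewrite geq_max => /andP[bn dn] s x t s0 sx xt tb ts.
have st := le_trans sx xt; have t0 := le_trans s0 st.
have {}bn : b <= n%:R.
  by rewrite ltW// (lt_le_trans (archi_boundP b0))// ler_nat.
have {}dn : n.+1%:R^-1 < d / 2.
  rewrite invf_plt ?posrE ?divr_gt0// invf_div.
  rewrite (lt_le_trans (archi_boundP _)) ?divr_ge0 ?ltW//.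
  by rewrite ltr_nat ltnS.
have tn := le_trans tb bn; have sn := le_trans st tn.
pose c k := width n k t - width n k s.
have sumc : \sum_(k < n.+1 * n.+1) c k = t - s.
  by rewrite sumrB !sum_width.
have -> : step f n t - step f n s - (t - s)%:C *: f x =
   \sum_(k < n.+1 * n.+1) (c k)%:C *: (f (node n k) - f x).
  rewrite -sumc rmorph_sum/= scaler_suml -!sumrB; apply: eq_bigr => k _.
  by rewrite /c; vector_identity (R[i]) [:: f (node n k); f x]; ring.
rewrite (le_trans (nrm_sum _ _ _))// -sumc mulr_sumr ler_sum// => k _.
have [c0 [->|[kt sk]]] : 0 <= c k /\ (c k = 0 \/ _) := widthP n k st.
  by rewrite scale0r nrm0 mulr0.
rewrite nrmZr_ge0// mulrC ler_wpM2r//.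
have k0 : 0 <= node n k by rewrite divr_ge0.
move: (n.+1%:R^-1) dn sk => hh dn sk.
have [kx|xk] := leP (node n k) x.
  rewrite nrmBC h//; lra.
rewrite h//; lra.
Qed.

(** By [step_approx] the increments of two step primitives are close to the same (t - s) f(s), so
    they form a Cauchy sequence at each t; the limit inherits the estimate. *)
Lemma prim_exists f : ucont f -> exists2 F, is_prim f F & F 0 = 0.
Proof.
move=> cf.
have step0 n : step f n 0 = 0.
  rewrite /step big1// => k _; rewrite /width !(min_idPl _) ?divr_ge0//.
  by rewrite subrr scale0r.
have cau t : 0 <= t -> forall e : R, 0 < e -> exists N, forall n m, (N <= n)%N -> (N <= m)%N ->
     nrm (step f n t - step f m t) <= e.
  move=> t0 e e0; have t1 : 0 < t + 1 by rewrite ltr_wpDl.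
  have k0 : 0 < e / 2 / (t + 1) by rewrite !divr_gt0.
  have [N [d d0 hN]] := step_approx cf t0 k0.
  exists N => n m Nn Nm.
  pose G u := step f n u - step f m u.
  have G0 : G 0 = 0 by rewrite /G !step0 subrr.
  have : nrm (G t - G 0) <= 2 * (e / 2 / (t + 1)) * (t - 0).
    apply: (@itv_chain_ind R (fun s u => nrm (G u - G s) <= 2 * (e / 2 / (t + 1)) * (u - s))
        0 t d) => //.
    - move=> s u s0 su ut us.
      have h1 := hN n Nn s s u s0 (lexx _) su ut us.
      have h2 := hN m Nm s s u s0 (lexx _) su ut us.
      have -> : G u - G s = (step f n u - step f n s - (u - s)%:C *: f s) -
         (step f m u - step f m s - (u - s)%:C *: f s).
        rewrite /G; vector_identity (R[i])
          [:: step f n u; step f m u; step f n s; step f m s; f s]; ring.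
      by rewrite (le_trans (nrmB _ _))//; lra.
    - move=> s u v _ _ _ _ h1 h2; rewrite (le_trans (nrm_tri (G u) _ _))//; lra.
  rewrite G0 !subr0 => /le_trans; apply.
  rewrite mulrA mulrCA divff ?pnatr_eq0// mulr1 mulrAC ler_pdivrMr//.
  by rewrite ler_pM2l//; lra.
have /choice [F hF] : forall t, exists l, 0 <= t ->
    forall e : R, 0 < e -> exists N, forall n, (N <= n)%N -> nrm (step f n t - l) <= e.
  move=> t; have [t0|t0] := leP 0 t; last by exists 0.
  by have [l hl] := nrm_complete (cau t t0); exists l.
exists F; last first.
  apply: nrm_le_small => e e0; have [N /(_ N (leqnn _))] := hF 0 (lexx _) e e0.
  by rewrite step0 sub0r nrmN.
move=> b e b0 e0; have [N [d d0 hN]] := step_approx cf b0 e0.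
exists d => // s x t s0 sx xt tb ts.
apply/ler_addgt0Pr => k k0; have k20 : 0 < k / 2 by rewrite divr_gt0.
have st := le_trans sx xt; have t0 := le_trans s0 st.
have [N1 h1] := hF s s0 _ k20; have [N2 h2] := hF t t0 _ k20.
pose n := maxn N (maxn N1 N2).
have {}h1 : nrm (step f n s - F s) <= k / 2.
  by apply: h1; rewrite /n !leq_max leqnn !orbT.
have {}h2 : nrm (step f n t - F t) <= k / 2.
  by apply: h2; rewrite /n !leq_max leqnn !orbT.
have h3 := hN n (leq_maxl _ _) s x t s0 sx xt tb ts.
have -> : F t - F s - (t - s)%:C *: f x =
   (step f n t - step f n s - (t - s)%:C *: f x) +
   ((step f n s - F s) - (step f n t - F t)).
  by vector_identity (R[i]) [:: F t; F s; f x; step f n t; step f n s]; ring.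
rewrite (le_trans (nrmD _ _))// lerD//.
by rewrite (le_trans (nrmB _ _))// [k]splitr lerD.
Qed.

End Existence.

(** * Improper integrals and closed linear relations *)

(** A closed subspace of E x E. Besides the graphs of A and C the diagonal is an instance, and it
    yields uniqueness of integrals and of transforms. *)
Definition closed_relation (R : realType) (E : normedModType R[i])
    (P : E -> E -> Prop) : Prop :=
  [/\ P 0 0,
      forall (a : R[i]) x y x' y', P x y -> P x' y' -> P (a *: x + x') (a *: y + y') &
      forall x y, (forall e : R, 0 < e ->
        exists x' y', [/\ P x' y', nrm (x - x') <= e & nrm (y - y') <= e]) -> P x y].

Definition cvg_pinfty (R : realType) (E : normedModType R[i]) (F : R -> E) (v : E) : Prop :=
  forall e : R, 0 < e -> exists2 B : R, 0 <= B & forall b, B <= b -> nrm (F b - v) <= e.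

Definition improper_int (R : realType) (E : normedModType R[i]) (f : R -> E) (v : E) : Prop :=
  exists F, [/\ is_prim f F, F 0 = 0 & cvg_pinfty F v].

Section ClosedRelation.
Context (R : realType) (E : normedModType R[i]) (P : E -> E -> Prop).
Hypothesis Pclosed : closed_relation P.

Lemma closed_relationD x y x' y' : P x y -> P x' y' -> P (x + x') (y + y').
Proof.
by case: Pclosed => _ Pl _ xy xy'; have := Pl 1 x y x' y' xy xy'; rewrite !scale1r.
Qed.

Lemma closed_relationZ (a : R[i]) x y : P x y -> P (a *: x) (a *: y).
Proof.
by case: Pclosed => P0 Pl _ xy; have := Pl a x y 0 0 xy P0; rewrite !addr0.
Qed.

(** Riemann sums of f and g over the same tags form a pair in P, and these pairs approximate the
    pair of increments. *)
Lemma prim_closed_relation (f g F G : R -> E) (b : R) : 0 <= b -> is_prim f F -> is_prim g G ->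
  (forall t, 0 <= t -> P (f t) (g t)) -> P (F b - F 0) (G b - G 0).
Proof.
move=> b0 fF gG fg; case: (Pclosed) => _ _; apply => e e0.
have k0 : 0 < e / (b + 1) by rewrite divr_gt0// ltr_wpDl.
have [d d0 h] := fF b _ b0 k0; have [d' d'0 h'] := gG b _ b0 k0.
set k := e / (b + 1) in k0 h h'.
have [x [y [xy hx hy]]] : exists x y, [/\ P x y,
    nrm (F b - F 0 - x) <= k * (b - 0) & nrm (G b - G 0 - y) <= k * (b - 0)].
  apply: (@itv_chain_ind R (fun s t => exists x y, [/\ P x y,
    nrm (F t - F s - x) <= k * (t - s) & nrm (G t - G s - y) <= k * (t - s)])
    0 b (Num.min d d')) => //; last by rewrite lt_min d0.
  - move=> s t s0 st tb; rewrite lt_min => /andP[td td'].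
    exists ((t - s)%:C *: f s), ((t - s)%:C *: g s); split.
    + exact/closed_relationZ/fg.
    + exact: h.
    + exact: h'.
  - move=> s t u _ _ _ _ [x [y [xy hx hy]]] [x' [y' [xy' hx' hy']]].
    exists (x + x'), (y + y'); split; first exact: closed_relationD.
    + have -> : F u - F s - (x + x') = (F u - F t - x') + (F t - F s - x).
        by vector_identity (R[i]) [:: F u; F s; F t; x; x']; ring.
      rewrite (le_trans (nrmD _ _))//; lra.
    + have -> : G u - G s - (y + y') = (G u - G t - y') + (G t - G s - y).
        by vector_identity (R[i]) [:: G u; G s; G t; y; y']; ring.
      rewrite (le_trans (nrmD _ _))//; lra.
have kb : k * (b - 0) <= e.
  by rewrite subr0 /k mulrAC ler_pdivrMr ?ltr_wpDl// ler_pM2l//; lra.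
exists x, y; split => //; exact: le_trans kb.
Qed.

Lemma cvg_pinfty_closed_relation (F G : R -> E) v w :
  (forall b, 0 <= b -> P (F b) (G b)) ->
  cvg_pinfty F v -> cvg_pinfty G w -> P v w.
Proof.
move=> FG Fv Gw; case: (Pclosed) => _ _; apply => e e0.
have [B B0 h] := Fv e e0; have [B' B'0 h'] := Gw e e0.
have BB : B <= Num.max B B' by rewrite le_max lexx.
have BB' : B' <= Num.max B B' by rewrite le_max lexx orbT.
exists (F (Num.max B B')), (G (Num.max B B')); split.
- by apply: FG; exact: le_trans BB.
- by rewrite nrmBC; exact: h.
- by rewrite nrmBC; exact: h'.
Qed.

Lemma improper_int_closed_relation (f g : R -> E) v w :
  (forall t, 0 <= t -> P (f t) (g t)) -> improper_int f v -> improper_int g w -> P v w.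
Proof.
move=> fg [F [fF F0 Fv]] [G [gG G0 Gw]].
apply: cvg_pinfty_closed_relation Fv Gw => b b0.
by have := prim_closed_relation b0 fF gG fg; rewrite F0 G0 !subr0.
Qed.

End ClosedRelation.

Lemma eq_closed_relation (R : realType) (E : normedModType R[i]) :
  closed_relation (fun x y : E => x = y).
Proof.
split=> [//|a x y x' y' -> -> //|x y h].
apply/eqP; rewrite -subr_eq0; apply/eqP; apply: nrm_le_small => e e0.
have [z [_ [<- h1 h2]]] := h (e / 2) (divr_gt0 e0 (ltr0n _ 2)).
by rewrite (le_trans (nrm_tri z _ _))// [e]splitr lerD// nrmBC.
Qed.

Section Improper.
Context (R : realType) (E : normedModType R[i]).
Implicit Types (f g F G : R -> E) (v w : E).

Lemma cvg_pinfty_lin (a : R[i]) F G v w : cvg_pinfty F v -> cvg_pinfty G w ->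
  cvg_pinfty (fun t => a *: F t + G t) (a *: v + w).
Proof.
move=> Fv Gw e e0.
pose k := nrm (a : R[i]^o) + 1.
have k0 : 0 < k by rewrite ltr_wpDl// nrm_ge0.
have [B B0 h] := Fv (e / 2 / k) (divr_gt0 (divr_gt0 e0 (ltr0n _ 2)) k0).
have [B' B'0 h'] := Gw (e / 2) (divr_gt0 e0 (ltr0n _ 2)).
exists (Num.max B B'); first by rewrite le_max B0.
move=> b; rewrite ge_max => /andP[Bb B'b].
rewrite opprD addrACA -scalerBr.
apply: (le_trans (nrmD _ _)); rewrite nrmZ [e]splitr lerD//; last exact: h'.
apply: (@le_trans _ _ (k * (e / 2 / k))).
  by apply: ler_pM => //; rewrite ?nrm_ge0 ?lerDl//; exact: h.
by rewrite mulrC divfK// gt_eqF.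
Qed.

Lemma eq_cvg_pinfty F G v : (forall t, 0 <= t -> F t = G t) ->
  cvg_pinfty F v -> cvg_pinfty G v.
Proof.
move=> FG Fv e e0; have [B B0 h] := Fv e e0; exists B => // b Bb.
by rewrite -FG; [exact: h|exact: le_trans Bb].
Qed.

Lemma cvg_pinfty_cst v : cvg_pinfty (fun=> v) v.
Proof. by move=> e e0; exists 0 => // b _; rewrite subrr nrm0 ltW. Qed.

Lemma cvg_pinfty_bound F v x (c B : R) : 0 <= B ->
  (forall b, B <= b -> nrm (F b - x) <= c) -> cvg_pinfty F v -> nrm (v - x) <= c.
Proof.
move=> B0 Fc Fv; apply/ler_addgt0Pr => e e0; have [B' B'0 h] := Fv e e0.
have h1 : nrm (F (Num.max B B') - x) <= c by apply: Fc; rewrite le_max lexx.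
have h2 : nrm (F (Num.max B B') - v) <= e by apply: h; rewrite le_max lexx orbT.
by rewrite (le_trans (nrm_tri (F (Num.max B B')) _ _))// addrC lerD// nrmBC.
Qed.

Lemma eq_improper_int f g v : (forall t, 0 <= t -> f t = g t) ->
  improper_int f v -> improper_int g v.
Proof.
move=> fg [F [fF F0 Fv]]; exists F; split => //.
by apply: eq_prim fF.
Qed.

Lemma improper_int_lin (a : R[i]) f g v w : improper_int f v -> improper_int g w ->
  improper_int (fun t => a *: f t + g t) (a *: v + w).
Proof.
move=> [F [fF F0 Fv]] [G [gG G0 Gw]]; exists (fun t => a *: F t + G t); split.
- exact: prim_lin.
- by rewrite F0 G0 scaler0 addr0.
- exact: cvg_pinfty_lin.
Qed.

Lemma improper_int0 : improper_int (fun=> 0) (0 : E).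
Proof. by exists (fun=> 0); split => //; [exact: prim_cst|exact: cvg_pinfty_cst]. Qed.

Lemma improper_intZ (a : R[i]) f v : improper_int f v -> improper_int (fun t => a *: f t) (a *: v).
Proof.
move=> fv; have := improper_int_lin a fv improper_int0; rewrite addr0.
by apply: eq_improper_int => t _; rewrite addr0.
Qed.

Lemma improper_intB f g v w : improper_int f v -> improper_int g w ->
  improper_int (fun t => f t - g t) (v - w).
Proof.
move=> fv gw; have := improper_int_lin (-1) gw fv; rewrite scaleN1r addrC.
by apply: eq_improper_int => t _; rewrite scaleN1r addrC.
Qed.

Lemma improper_int_unique f v w : improper_int f v -> improper_int f w -> v = w.
Proof.
exact: (improper_int_closed_relation (@eq_closed_relation R E)).
Qed.

Lemma improper_int_tail f F v (c k t : R) : 0 <= t -> 0 < k -> is_prim f F -> cvg_pinfty F v ->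
  (forall s, t <= s -> nrm (f s) <= c * expR (- k * s)) ->
  nrm (v - F t) <= c / k * expR (- k * t).
Proof.
move=> t0 k0 fF Fv fc.
have c0 : 0 <= c.
  have := le_trans (nrm_ge0 _) (fc t (lexx _)).
  by rewrite pmulr_lge0// expR_gt0.
apply: (cvg_pinfty_bound t0) Fv => b tb.
have kN0 : - k != 0 by rewrite oppr_eq0 gt_eqF.
rewrite (le_trans (prim_bound_expR t0 tb kN0 fF (fun s ts _ => fc s ts)))//.
rewrite invrN mulrN mulNr -mulrN opprB ler_wpM2l ?divr_ge0 ?(ltW k0)//.
by rewrite gerBl expR_ge0.
Qed.

Lemma improper_int_bound f v (c k : R) : 0 < k ->
  (forall s, 0 <= s -> nrm (f s) <= c * expR (- k * s)) -> improper_int f v ->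
  nrm v <= c / k.
Proof.
move=> k0 fc [F [fF F0 Fv]].
by have := improper_int_tail (lexx _) k0 fF Fv fc; rewrite F0 subr0 mulr0 expR0 mulr1.
Qed.

Lemma cvg_pinftyP F v : F b @[b --> +oo%R] --> v <-> cvg_pinfty F v.
Proof.
split=> [/cvgrPdist_le h e e0|h].
  have /h [B [Breal hB]] : (0 : R[i]) < e%:C by rewrite (ltcR 0).
  exists (Num.max 0 (B + 1)); first by rewrite le_max lexx.
  move=> b; rewrite ge_max => /andP[b0 Bb].
  have /hB : B < b by lra.
  by rewrite nrmE lecR nrmBC.
apply/cvgrPdist_le => e; rewrite ltcE/= => /andP[/eqP Ie e0].
have [B B0 hB] := h _ e0; exists B; split; first exact: num_real.
by move=> b /ltW Bb /=; rewrite nrmE lecE/= Ie eqxx/= nrmBC hB.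
Qed.

End Improper.

Section ImproperComplete.
Context (R : realType) (E : completeNormedModType R[i]).
Implicit Types (f g F G : R -> E) (v w : E).

Lemma expRN_small (k e : R) : 0 < k -> 0 < e ->
  exists2 B : R, 0 <= B & forall b, B <= b -> expR (- k * b) <= e.
Proof.
(* From exp(kb) >= 1 + kb: the value 1 / e is exceeded once kb >= 1 / e. *)
move=> k0 e0; exists (e^-1 / k); first by rewrite !divr_ge0// ?invr_ge0 ltW.
move=> b Bb; rewrite mulNr expRN invf_ple ?posrE ?expR_gt0//.
rewrite ler_pdivrMr// mulrC in Bb; rewrite (le_trans Bb)//.
by rewrite (le_trans _ (expR_ge1Dx _))// lerDr.
Qed.

Lemma cvg_pinfty_exists f F (c k : R) : 0 < k -> is_prim f F ->
  (forall s, 0 <= s -> nrm (f s) <= c * expR (- k * s)) -> exists v, cvg_pinfty F v.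
Proof.
move=> k0 fF fc.
have c0 := exp_bound_ge0 fc.
have FF s t : 0 <= s -> s <= t -> nrm (F t - F s) <= c / k * expR (- k * s).
  move=> s0 st.
  have kN0 : - k != 0 by rewrite oppr_eq0 gt_eqF.
  rewrite (le_trans (prim_bound_expR s0 st kN0 fF
    (fun x sx _ => fc x (le_trans s0 sx))))//.
  rewrite invrN mulrN mulNr -mulrN opprB ler_wpM2l ?divr_ge0 ?(ltW k0)//.
  by rewrite gerBl expR_ge0.
have small e : 0 < e -> exists2 B : R, 0 <= B & forall s t, B <= s -> s <= t ->
    nrm (F t - F s) <= e.
  move=> e0; have e1 : 0 < e / (c / k + 1).
    by rewrite divr_gt0// ltr_wpDl// divr_ge0// ltW.
  have [B B0 h] := expRN_small k0 e1; exists B => // s t Bs st.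
  rewrite (le_trans (FF s t (le_trans B0 Bs) st))//.
  rewrite (le_trans (ler_wpM2l _ (h s Bs))) ?divr_ge0 ?(ltW k0)//.
  rewrite mulrCA ler_piMr ?(ltW e0)// ler_pdivrMr ?ltr_wpDl ?divr_ge0 ?(ltW k0)//.
  by rewrite mul1r lerDl.
(* The limit is taken along the integers; the Cauchy estimate [small] carries it over to real b. *)
have [v hv] : exists v, forall e : R, 0 < e -> exists N, forall n, (N <= n)%N ->
    nrm (F n%:R - v) <= e.
  apply: nrm_complete => e e0; have [B B0 h] := small e e0.
  exists (Num.bound B) => n m Bn Bm.
  have {}Bn : B <= n%:R by rewrite ltW// (lt_le_trans (archi_boundP B0))// ler_nat.
  have {}Bm : B <= m%:R by rewrite ltW// (lt_le_trans (archi_boundP B0))// ler_nat.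
  have [nm|mn] := leqP n m.
    by rewrite nrmBC h// ler_nat.
  by rewrite h// ler_nat ltnW.
exists v => e e0; have e20 : 0 < e / 2 by rewrite divr_gt0.
have [B B0 h] := small _ e20; have [N hN] := hv _ e20.
exists (Num.max B N%:R); first by rewrite le_max B0.
move=> b; rewrite ge_max => /andP[Bb Nb].
pose n := maxn (Num.bound b) N.
have bn : b <= n%:R.
  rewrite ltW// (lt_le_trans (archi_boundP _)) ?(le_trans _ Nb)// ler_nat.
  exact: leq_maxl.
rewrite (le_trans (nrm_tri (F n%:R) _ _))// [e]splitr lerD//.
  by rewrite nrmBC h.
by rewrite hN// leq_maxr.
Qed.

Lemma improper_int_exists f (c k : R) : 0 < k -> ucont f ->
  (forall s, 0 <= s -> nrm (f s) <= c * expR (- k * s)) -> exists v, improper_int f v.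
Proof.
move=> k0 cf fc; have [F fF F0] := prim_exists cf.
by have [v Fv] := cvg_pinfty_exists k0 fF fc; exists v, F.
Qed.

Lemma improper_int_is_RInt_oo f v : improper_int f v -> is_RInt_oo f v.
Proof.
move=> [F [fF F0 Fv]]; exists F; split; last exact/cvg_pinftyP.
by move=> b b0; have := prim_is_RInt (lexx _) b0 fF; rewrite F0 subr0.
Qed.

Lemma is_RInt_oo_improper_int f v : ucont f -> is_RInt_oo f v -> improper_int f v.
Proof.
move=> cf [G [fG /cvg_pinftyP Gv]]; have [F fF F0] := prim_exists cf.
exists F; split => //; apply: eq_cvg_pinfty Gv => b b0.
apply: (is_RInt_unique b0 (fG b b0)).
by have := prim_is_RInt (lexx _) b0 fF; rewrite F0 subr0.
Qed.

End ImproperComplete.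

(** * Exponentials and Laplace transforms *)

Section Exponential.
Context (R : realType).
Implicit Types (z w l : R[i]).

Lemma cexp_real (r : R) : cexp r%:C = (expR r)%:C.
Proof. by rewrite /cexp/= cos0 sin0 mulr1 mulr0. Qed.

Lemma nrm_cexp z : nrm (cexp z : R[i]^o) = expR (complex.Re z).
Proof.
by rewrite /nrm normc_def/= !exprMn -mulrDr cos2Dsin2 mulr1 sqrtr_sqr ger0_norm.
Qed.

(** Heine's theorem from the near-covering form of compactness, with the modulus d as the parameter
    that tends to 0 from the right. The scalars k are arbitrary because both real-valued and
    E-valued functions occur. *)
Lemma segment_unif_continuous (k : numFieldType) (V : normedModType k) (f : R -> V)
    (a b : R) (e : k) : 0 < e -> {within `[a, b], continuous f} ->
  exists2 d : R, 0 < d & forall s t, a <= s -> s <= b -> a <= t -> t <= b ->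
    `|s - t| < d -> `|f s - f t| <= e.
Proof.
move=> e0 /subspace_continuousP cf.
have /compact_near_coveringP H := @segment_compact R a b.
pose P (d s : R) := a <= s -> s <= b -> forall t, a <= t -> t <= b -> `|s - t| < d ->
  `|f s - f t| <= e.
have : \forall d \near 0^'+, `[a, b] `<=` P d.
  apply: H => x xab.
  have /cvgrPdist_le /(_ (e / 2) (divr_gt0 e0 (ltr0n _ 2))) := cf x xab.
  rewrite near_withinE => /nbhs_ballP[d /= d0 hd].
  have d20 : 0 < d / 2 by rewrite divr_gt0.
  exists ([set s | ball x (d / 2) s], [set r | r < d / 2]) => /=.
    by split; [exact: nbhsx_ballx|exact: nbhs_right_lt].
  move=> [s r] /= [xs rd] as_ sb t at_ tb str.
  rewrite -ball_normE/= in xs.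
  have xt : `|x - t| < d.
    rewrite (le_lt_trans (ler_distD s _ _))// [d]splitr ltrD//.
    exact: lt_trans rd.
  have hs : `|f x - f s| <= e / 2.
    apply: hd; last by rewrite /= in_itv/= as_.
    by rewrite -ball_normE/= (lt_le_trans xs)// ler_pdivrMr// ler_peMr ?ler1n// ltW.
  have ht : `|f x - f t| <= e / 2.
    by apply: hd; [rewrite -ball_normE|rewrite /= in_itv/= at_].
  by rewrite (le_trans (ler_distD (f x) _ _))// [e]splitr lerD// distrC.
move=> /(filterI (nbhs_right_gt 0)) /(@filter_ex _ _ _)[d /= [d0 hd]].
exists d => // s t as_ sb at_ tb st.
by apply: hd st => //=; rewrite in_itv/= as_.
Qed.

Lemma ucont_within (E : normedModType R[i]) (f : R -> E) :
  {within `[0, +oo[, continuous f} -> ucont f.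
Proof.
move=> cf b e b0 e0.
have {}cf : {within `[0, b], continuous f}.
  by apply: continuous_subspaceW cf => x /=; rewrite !in_itv/= => /andP[->].
have e0C : (0 : R[i]) < e%:C by rewrite (ltcR 0).
have [d d0 h] := segment_unif_continuous e0C cf.
exists d => // s t s0 st tb ts; rewrite -lecR -nrmE; apply: h => //.
- exact: le_trans st.
- exact: le_trans tb.
- by rewrite ger0_norm// subr_ge0.
Qed.

(** The mean value theorem writes the increment as g'(y)(t - s), and uniform continuity of g'
    exchanges y for the prescribed tag. *)
Lemma prim_real (g g' : R -> R) : (forall t : R, is_derive t 1 g (g' t)) -> continuous g' ->
  is_prim (fun t => (g' t)%:C : R[i]^o) (fun t => (g t)%:C : R[i]^o).
Proof.
move=> dg cg b e b0 e0.
have [d d0 h] := @segment_unif_continuous R R g' 0 b e e0 (continuous_subspaceT cg).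
exists d => // s x t s0 sx xt tb ts.
have st := le_trans sx xt.
rewrite -!rmorphB/= -[_%:C *: _]/(_%:C * _) -rmorphM/= -rmorphB/= nrm_real.
move: st; rewrite le_eqVlt => /predU1P[st|st].
  by rewrite st !subrr mul0r subrr normr0 mulr0.
have cgst : {within `[s, t], continuous g}.
  by apply: derivable_within_continuous => y _; exact: ex_derive.
have [y /[!in_itv]/= /andP[sy yt] ->] := MVT st (fun x _ => dg x) cgst.
rewrite mulrC -mulrBr normrM ger0_norm ?subr_ge0 ?(ltW st)// mulrC.
rewrite ler_wpM2r ?subr_ge0 ?(ltW st)// h//; try lra.
by rewrite ltr_norml; apply/andP; split; lra.
Qed.

(** With values in [R[i]^o] the kernel is itself a vector-valued function, to which the calculus of
    primitives applies. *)
Definition exp_ker (l : R[i]) (t : R) : R[i]^o := cexp (- (l * t%:C)).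

Lemma kerE l t : exp_ker l t =
  (expR (- complex.Re l * t) * cos (complex.Im l * t))%:C -
  'i * (expR (- complex.Re l * t) * sin (complex.Im l * t))%:C.
Proof.
case: l => a b; rewrite /exp_ker /cexp/= !mulr0 subr0 add0r cosN sinN -mulNr.
by apply/eqP; rewrite eq_complex/=; apply/andP; split; apply/eqP; ring.
Qed.

Lemma prim_ker l : is_prim (fun t => - l *: exp_ker l t) (exp_ker l).
Proof.
case: l => a b.
pose p t := expR (- a * t) * cos (b * t); pose q t := expR (- a * t) * sin (b * t).
pose p' t := - a * p t - b * q t; pose q' t := - a * q t + b * p t.
have dp (t : R) : is_derive t 1 p (p' t).
  by apply: is_derive_eq; rewrite /p' /p /q /GRing.scale/=; ring.
have dq (t : R) : is_derive t 1 q (q' t).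
  by apply: is_derive_eq; rewrite /q' /p /q /GRing.scale/=; ring.
have cp : continuous p.
  by move=> t; apply/differentiable_continuous/derivable1_diffP; exact: ex_derive.
have cq : continuous q.
  by move=> t; apply/differentiable_continuous/derivable1_diffP; exact: ex_derive.
have cp' : continuous p'.
  by move=> t; apply: cvgB; apply: cvgM; try exact: cvg_cst; [exact: cp|exact: cq].
have cq' : continuous q'.
  by move=> t; apply: cvgD; apply: cvgM; try exact: cvg_cst; [exact: cq|exact: cp].
apply: eq_prim (prim_lin (- 'i) (prim_real dq cq') (prim_real dp cp')) => t _.
  rewrite kerE/= -/(p t) -/(q t) /GRing.scale/= /p' /q'.
  by apply/eqP; rewrite eq_complex/=; apply/andP; split; apply/eqP; ring.
by rewrite kerE/= -/(p t) -/(q t) scaleNr addrC.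
Qed.

Lemma ucont_ker l : ucont (exp_ker l).
Proof. exact: prim_prim_ucont (prim_ker l). Qed.

Lemma nrm_ker l t : nrm (exp_ker l t) = expR (- complex.Re l * t).
Proof. by case: l => a b; rewrite nrm_cexp/= mulr0 subr0 mulNr. Qed.

Lemma ker_real (r t : R) : exp_ker r%:C t = (expR (- r * t))%:C.
Proof. by rewrite /exp_ker -rmorphM/= -rmorphN/= cexp_real mulNr. Qed.

End Exponential.

Lemma nrm_ker_scale (R : realType) (E : normedModType R[i]) (f : R -> E)
    (c k : R) l : (forall t, 0 <= t -> nrm (f t) <= c * expR (k * t)) ->
  forall t, 0 <= t -> nrm (exp_ker l t *: f t) <= c * expR (- (complex.Re l - k) * t).
Proof.
move=> fc t t0; rewrite nrmZ nrm_ker.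
rewrite (le_trans (ler_wpM2l (expR_ge0 _) (fc t t0)))// mulrCA -expRD.
by rewrite le_eqVlt; apply/orP; left; apply/eqP; congr (_ * expR _); ring.
Qed.

Lemma prim_exp_bound (R : realType) (E : normedModType R[i]) (f F : R -> E) (c k : R) :
  is_prim f F -> F 0 = 0 -> 0 < k ->
  (forall t, 0 <= t -> nrm (f t) <= c * expR (k * t)) ->
  forall t, 0 <= t -> nrm (F t) <= c / k * expR (k * t).
Proof.
move=> fF F0 k0 fc t t0.
have c0 := exp_bound_ge0 fc.
have := prim_bound_expR (lexx _) t0 (lt0r_neq0 k0) fF (fun s s0 _ => fc s s0).
rewrite F0 subr0 => /le_trans; apply.
by rewrite ler_wpM2l ?divr_ge0 ?(ltW k0)// gerBl expR_ge0.
Qed.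

Section LaplaceTransform.
Context (R : realType) (E : completeNormedModType R[i]).
Implicit Types (f F : R -> E) (l : R[i]).

Definition has_laplace f l (v : E) : Prop := improper_int (fun t => exp_ker l t *: f t) v.

Lemma has_laplace_exists f (c k : R) l : ucont f -> k < complex.Re l ->
  (forall t, 0 <= t -> nrm (f t) <= c * expR (k * t)) -> exists v, has_laplace f l v.
Proof.
move=> cf; rewrite -subr_gt0 => kl fc.
exact: (improper_int_exists kl (ucont_scale (ucont_ker l) cf) (nrm_ker_scale l fc)).
Qed.

Lemma laplace_prim f F l v (c k : R) : is_prim f F -> F 0 = 0 -> 0 < k ->
    k < complex.Re l -> (forall t, 0 <= t -> nrm (f t) <= c * expR (k * t)) ->
  has_laplace f l v -> has_laplace F l (l^-1 *: v).
Proof.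
move=> fF F0 k0 kl fc [V [fV V0 Vv]].
have c0 := exp_bound_ge0 fc.
have l0 : l != 0.
  by apply: contraTneq kl => ->; rewrite /= -leNgt ltW.
have FB := prim_exp_bound fF F0 k0 fc.
(* Partial integration; the boundary term vanishes at infinity because F grows at most like exp(kt)
   with k < Re l. *)
exists (fun t => l^-1 *: (V t - exp_ker l t *: F t)); split.
- have := primZ l^-1 (primB fV (prim_scale (prim_ker l) fF)).
  apply: eq_prim => t _ //.
  rewrite opprD addrA addrAC subrr add0r scaleNr scaleNr opprK scalerA.
  by rewrite -[l *: exp_ker l t]/(l * exp_ker l t) mulKf.
- by rewrite V0 F0 scaler0 subrr scaler0.
- have kF : cvg_pinfty (fun t => exp_ker l t *: F t) 0.
    move=> e e0; have lk0 : 0 < complex.Re l - k by rewrite subr_gt0.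
    have ck : 0 < c / k + 1 by rewrite ltr_wpDl// divr_ge0// ltW.
    have [B B0 h] := expRN_small lk0 (divr_gt0 e0 ck).
    exists B => // b Bb; rewrite subr0.
    rewrite (le_trans (nrm_ker_scale l FB (le_trans B0 Bb)))//.
    rewrite (le_trans (ler_wpM2l _ (h _ Bb))) ?divr_ge0 ?(ltW k0)//.
    by rewrite mulrCA ler_piMr ?(ltW e0)// ler_pdivrMr// mul1r lerDl.
  have := cvg_pinfty_lin l^-1 (cvg_pinfty_lin (-1) kF Vv) (@cvg_pinfty_cst R E 0).
  rewrite scaler0 add0r addr0; apply: eq_cvg_pinfty => t _.
  by rewrite addr0 scaleN1r addrC.
Qed.

End LaplaceTransform.

(** * Integrals of locally integrable scalar functions *)

Section LocallyIntegrable.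
Context (R : realType).
Notation mu := (@lebesgue_measure R).
Implicit Types (u p : R -> R).

Definition locint u := forall b : R, 0 <= b -> mu.-integrable `[0, b] (EFin \o u).

Definition primint u (t : R) : R := \int[mu]_(x in `[0, t]) u x.

Lemma locint_norm u : locint u -> locint (fun x => `|u x|).
Proof. by move=> iu b b0; exact: integrable_norm (iu b b0). Qed.

Lemma locintM u p : continuous p -> locint u -> locint (fun x => p x * u x).
Proof.
move=> cp iu b b0.
apply: (@integrableMr _ _ _ mu `[0, b] _ p (EFin \o u)) => //; last exact: iu.
  by apply: measurable_funTS; exact: continuous_measurable_fun.
have [M [Mreal hM]] := compact_bounded
  (continuous_compact (continuous_subspaceT cp) (@segment_compact R 0 b)).
exists M; split => // x Mx y yb; apply: (hM x Mx (p y)).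
by exists y.
Qed.

Lemma locintB u v : locint u -> locint v -> locint (fun x => u x - v x).
Proof. by move=> iu iv b b0; apply: integrableB (iu b b0) (iv b b0). Qed.

Lemma primintB u s t : locint u -> 0 <= s -> s <= t ->
  primint u t - primint u s = \int[mu]_(x in `]s, t]) u x.
Proof.
move=> iu s0 st; rewrite /primint.
by apply: Rintegral_itvB; [exact/iu/(le_trans s0)|rewrite bnd_simp|rewrite bnd_simp].
Qed.

Lemma locint_oc u s t : locint u -> 0 <= s -> s <= t ->
  mu.-integrable `]s, t] (EFin \o u).
Proof.
move=> iu s0 st; apply: integrableS (iu t (le_trans s0 st)) => // x /=.
by rewrite !in_itv/= => /andP[sx ->]; rewrite (le_trans s0)// ltW.
Qed.

(** Freezing the continuous factor p at c costs at most M times the mass of |u| on ]s, t]; u itself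
    may be unbounded. *)
Lemma primint_remainder u p (s t c M : R) : locint u -> continuous p ->
  0 <= s -> s <= t -> (forall x, s <= x -> x <= t -> `|p x - c| <= M) ->
  `|(primint (fun x => p x * u x) t - primint (fun x => p x * u x) s) -
    c * (primint u t - primint u s)| <=
  M * (primint (fun x => `|u x|) t - primint (fun x => `|u x|) s).
Proof.
move=> iu cp s0 st hM.
have ipu := locintM cp iu; have iau := locint_norm iu.
rewrite !primintB//.
have cc : continuous (fun x : R => p x - c).
  by move=> x; apply: cvgB; [exact: cp|exact: cvg_cst].
have ccst : continuous (cst c : R -> R) by move=> x; exact: cvg_cst.
have icu := locintM ccst iu.
rewrite -RintegralZl//; last exact: locint_oc.
rewrite -RintegralB//; [|exact: (locint_oc ipu)|exact: (locint_oc icu)].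
have idu := locintB ipu icu.
rewrite (le_trans (le_normr_Rintegral _ (locint_oc idu s0 st)))//.
rewrite -RintegralZl//; last exact: (locint_oc iau).
have icM : continuous (cst M : R -> R) by move=> x; exact: cvg_cst.
apply: le_Rintegral => //.
- exact: (locint_oc (locint_norm idu)).
- exact: (locint_oc (locintM icM iau)).
- move=> x /=; rewrite in_itv/= => /andP[sx xt].
  by rewrite -mulrBl normrM ler_wpM2r// hM// ltW.
Qed.

Lemma primint_unif_continuous u (b e : R) : locint u -> 0 <= b -> 0 < e ->
  exists2 d : R, 0 < d & forall s t, 0 <= s -> s <= t -> t <= b -> t - s < d ->
    `|primint u t - primint u s| <= e.
Proof.
move=> iu b0 e0.
have [d d0 h] := segment_unif_continuous e0
  (parameterized_integral_continuous b0 (iu b b0)).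
exists d => // s t s0 st tb ts; apply: h => //.
- exact: le_trans st.
- exact: le_trans tb.
- by rewrite ger0_norm// subr_ge0.
Qed.

Lemma primint_eq0 u : locint u -> (forall t, 0 <= t -> primint u t = 0) ->
  {ae mu, forall t, 0 <= t -> u t = 0}.
Proof.
move=> iu u0.
have H (n : nat) : {ae mu, forall t : R, 0 < t -> t < n%:R -> u t = 0}.
  (* Lebesgue differentiation for u cut off outside [0, n]: near a point of ]0, n[ the integral from
     0 is that of u, hence constantly 0. *)
  pose f := u \_ `[0, n%:R].
  have fint : mu.-integrable setT (EFin \o f).
    by rewrite /f -restrict_EFin -integrable_mkcond//; exact: iu.
  have locf : locally_integrable setT f.
    by apply: integrable_locally_restrict => //; exact: iu.
  have fy y : mu.-integrable `[0, y] (EFin \o f).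
    by apply: (integrableS _ _ (@subsetT _ _) fint).
  have := @FTC1 R f (BLeft 0) fy locf.
  apply: filterS; first exact: (ae_filter_ringOfSetsType mu).
  move=> x hx x0 xn; have [|_] := hx; first by rewrite /= lte_fin.
  have -> : f x = u x.
    by rewrite /f patchE mem_set//= in_itv/= !ltW.
  move=> <-; rewrite derive1E (@near_eq_derive _ _ _ _ (cst 0)); first exact: derive_cst.
  near=> y; have y0 : 0 <= y by apply: ltW; near: y; exact: lt_nbhsr.
  have yn : y <= n%:R by apply: ltW; near: y; exact: lt_nbhsl.
  rewrite -[RHS](u0 y y0); apply: eq_Rintegral => z; rewrite inE/= in_itv/= => /andP[z0 zy].
  by rewrite /f patchE mem_set//= in_itv/= z0 (le_trans zy).
(* Differentiation was applied at t > 0 only; the point 0 is a null set. *)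
have H0 : {ae mu, forall t : R, t != 0}.
  exists [set 0]; split => //; first exact: lebesgue_measure_set1.
  by move=> t /= /negP; rewrite negbK => /eqP.
have := ae_foralln H; move: H0.
apply: filterS2; first exact: (ae_filter_ringOfSetsType mu).
move=> t t0 ht; rewrite le_eqVlt eq_sym (negbTE t0)/= => tpos.
by apply: (ht (Num.bound t)) => //; rewrite archi_boundP// ltW.
Unshelve. all: by end_near. Qed.

End LocallyIntegrable.

(** * The Laplace transform of Theta *)

Lemma prim_lipschitz (R : realType) (E : normedModType R[i]) (f F : R -> E) (b : R) :
  is_prim f F -> 0 <= b -> exists2 L : R, 0 < L &
    forall s t, 0 <= s -> s <= t -> t <= b -> nrm (F t - F s) <= L * (t - s).
Proof.
move=> fF b0; have [L L0 hL] := ucont_bounded (prim_ucont fF) b0.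
exists L => // s t s0 st tb; rewrite mulrBr.
apply: (@prim_bound R E f F (fun=> L) (fun x => L * x)) => //.
  by move=> x sx xt; apply: hL; lra.
by move=> x y sx xy yt; exists x; split => //; rewrite mulrBr.
Qed.

Section ThetaLaplace.
Context (R : realType) (K : R -> R[i]) (hK : L1loc K).
Implicit Types l : R[i].

Let Kr x := complex.Re (K x).
Let Ki x := complex.Im (K x).
Let iKr : locint Kr. Proof. by move=> b b0; have [] := hK b0. Qed.
Let iKi : locint Ki. Proof. by move=> b b0; have [] := hK b0. Qed.
Let N t := primint (fun x => `|Kr x|) t + primint (fun x => `|Ki x|) t.

Lemma Theta0 : Theta K 0 = 0.
Proof. by rewrite /Theta /cintegral set_itv1 !Rintegral_set1. Qed.

Lemma laplace_partial0 l : laplace_partial K l 0 = 0.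
Proof. by rewrite /laplace_partial /cintegral set_itv1 !Rintegral_set1. Qed.

Lemma Theta_ucont : ucont (Theta K : R -> R[i]^o).
Proof.
move=> b e b0 e0; have e20 : 0 < e / 2 by rewrite divr_gt0.
have [d d0 h] := primint_unif_continuous iKr b0 e20.
have [d' d'0 h'] := primint_unif_continuous iKi b0 e20.
exists (Num.min d d'); first by rewrite lt_min d0.
move=> s t s0 st tb; rewrite lt_min => /andP[ts ts'].
by rewrite (le_trans (nrm_le_ReIm _))//= [e]splitr lerD ?h ?h'.
Qed.

(** One term of a Stieltjes sum, the kernel being frozen at the right end of [s, t]. The complex
    product consists of four real ones; real and imaginary part each contribute M(N(t) - N(s)),
    hence the factor 2. *)
Let laplace_partial_remainder l (s t M : R) : 0 <= s -> s <= t ->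
  (forall x, s <= x -> x <= t -> nrm (exp_ker l x - exp_ker l t) <= M) ->
  nrm (laplace_partial K l t - laplace_partial K l s -
    exp_ker l t * (Theta K t - Theta K s) : R[i]^o) <= 2 * M * (N t - N s).
Proof.
move=> s0 st hM.
pose a := complex.Re l; pose b := complex.Im l.
pose p x := expR (- a * x) * cos (b * x); pose q x := expR (- a * x) * sin (b * x).
have cp : continuous p.
  by move=> x; apply/differentiable_continuous/derivable1_diffP; exact: ex_derive.
have cq : continuous q.
  by move=> x; apply/differentiable_continuous/derivable1_diffP; exact: ex_derive.
have kE x : exp_ker l x = p x +i* (- q x).
  rewrite kerE -/a -/b -/(p x) -/(q x).
  by apply/eqP; rewrite eq_complex/=; apply/andP; split; apply/eqP; ring.
have pM x : s <= x -> x <= t -> `|p x - p t| <= M.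
  move=> sx xt; apply: le_trans (hM x sx xt); rewrite !kE.
  exact: le_trans (Re_le_nrm _).
have qM x : s <= x -> x <= t -> `|q x - q t| <= M.
  move=> sx xt; apply: le_trans (hM x sx xt).
  (* Multiplication by i turns the imaginary part into a real one, so that [Re_le_nrm] applies. *)
  have -> : nrm (exp_ker l x - exp_ker l t) = nrm ('i * (exp_ker l x - exp_ker l t) : R[i]^o).
    rewrite nrmM; have -> : nrm ('i : R[i]^o) = 1.
      by rewrite /nrm normc_def/= expr0n add0r expr1n sqrtr1.
    by rewrite mul1r.
  rewrite !kE; apply: le_trans (Re_le_nrm _) => /=.
  by rewrite mul0r mul1r !opprK sub0r opprD opprK.
have PE u : 0 <= u -> laplace_partial K l u =
  (primint (fun x => p x * Kr x) u + primint (fun x => q x * Ki x) u) +i*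
  (primint (fun x => p x * Ki x) u - primint (fun x => q x * Kr x) u).
  move=> u0; rewrite /laplace_partial /cintegral /primint.
  congr (_ +i* _).
    rewrite -RintegralD//; [|exact: (locintM cp iKr u0)|exact: (locintM cq iKi u0)].
    apply: eq_Rintegral => x _.
    by rewrite -/(exp_ker l x) kE /Kr /Ki; case: (K x) => ? ? /=; ring.
  rewrite -RintegralB//; [|exact: (locintM cp iKi u0)|exact: (locintM cq iKr u0)].
  apply: eq_Rintegral => x _.
  by rewrite -/(exp_ker l x) kE /Kr /Ki; case: (K x) => ? ? /=; ring.
have h1 := primint_remainder iKr cp s0 st pM; have h2 := primint_remainder iKi cq s0 st qM.
have h3 := primint_remainder iKi cp s0 st pM; have h4 := primint_remainder iKr cq s0 st qM.
rewrite !PE ?(le_trans s0)// kE /Theta /cintegral -/(primint Kr t) -/(primint Ki t)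
  -/(primint Kr s) -/(primint Ki s).
apply: le_trans (nrm_le_ReIm _) _ => /=.
have -> : 2 * M * (N t - N s) = M * (N t - N s) + M * (N t - N s) by ring.
have splitM : M * (N t - N s) =
   M * (primint (fun x => `|Kr x|) t - primint (fun x => `|Kr x|) s) +
   M * (primint (fun x => `|Ki x|) t - primint (fun x => `|Ki x|) s).
  by rewrite /N; ring.
rewrite splitM lerD//.
  apply: le_trans (lerD h1 h2); apply: le_trans (ler_normD _ _).
  by rewrite le_eqVlt; apply/orP; left; apply/eqP; congr (`| _ |); ring.
rewrite addrC; apply: le_trans (lerD h4 h3); apply: le_trans (ler_normB _ _).
by rewrite distrC le_eqVlt; apply/orP; left; apply/eqP; congr (`| _ |); ring.
Qed.

(* Partial integration int exp(-ls) dTheta(s), with K only integrable. *)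
Lemma prim_laplace_partial l :
  is_prim (fun t => l * (exp_ker l t * Theta K t) : R[i]^o)
       (fun t => laplace_partial K l t - exp_ker l t * Theta K t : R[i]^o).
Proof.
move=> b e b0 e0; have cT := Theta_ucont; have e30 : 0 < e / 3 by rewrite divr_gt0.
have [T T0 hT] := ucont_bounded cT b0.
have [Q Q0 hQ] := ucont_bounded (ucont_ker l) b0.
have [L L0 hL] := prim_lipschitz (prim_ker l) b0.
pose nl := nrm (l : R[i]^o) + 1.
have nl0 : 0 < nl by rewrite ltr_wpDl// nrm_ge0.
(* The 4 is the factor 2 of [laplace_partial_remainder] times the two summands of [N]. *)
have [d1 d10 h1] := primint_unif_continuous (locint_norm iKr) b0
  (divr_gt0 e30 (mulr_gt0 (ltr0n _ 4) L0)).
have [d2 d20 h2] := primint_unif_continuous (locint_norm iKi) b0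
  (divr_gt0 e30 (mulr_gt0 (ltr0n _ 4) L0)).
have [d3 d30 h3] := prim_ker l b0 (divr_gt0 e30 T0).
have [d4 d40 h4] := cT b _ b0 (divr_gt0 e30 (mulr_gt0 nl0 Q0)).
exists (Num.min (Num.min d1 d2) (Num.min d3 d4)); first by rewrite !lt_min d10 d20 d30.
move=> s x t s0 sx xt tb; rewrite !lt_min => /andP[/andP[td1 td2] /andP[td3 td4]].
have st := le_trans sx xt; have ts0 : 0 <= t - s by rewrite subr_ge0.
set P := laplace_partial K l; set Th := Theta K; set k := exp_ker l.
(* Three errors: the Stieltjes remainder, the remainder of the kernel as a primitive, and the
   variation of Theta between s and x. *)
have -> : P t - k t * Th t - (P s - k s * Th s) - (t - s)%:C *: (l * (k x * Th x) : R[i]^o) =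
  (P t - P s - k t * (Th t - Th s)) - (k t - k s - (t - s)%:C *: (- l *: k x)) * Th s
  + (t - s)%:C *: (l * k x * (Th s - Th x)).
  by rewrite /GRing.scale/=; ring.
have b1 : nrm (P t - P s - k t * (Th t - Th s) : R[i]^o) <= e / 3 * (t - s).
  apply: le_trans (@laplace_partial_remainder l s t (L * (t - s)) s0 st _) _.
    move=> y sy yt; rewrite nrmBC (le_trans (hL _ _ _ yt tb)) ?(le_trans s0)//.
    by rewrite ler_wpM2l ?(ltW L0)//; lra.
  have hN : N t - N s <= 2 * (e / 3 / (4 * L)).
    rewrite /N; have := h1 s t s0 st tb td1; have := h2 s t s0 st tb td2.
    rewrite !ler_norml => /andP[_ ?] /andP[_ ?]; lra.
  apply: le_trans (ler_wpM2l _ hN) _; first by rewrite !mulr_ge0// ltW.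
  by rewrite le_eqVlt; apply/orP; left; apply/eqP; field; rewrite gt_eqF.
have b2 : nrm ((k t - k s - (t - s)%:C *: (- l *: k x)) * Th s : R[i]^o) <= e / 3 * (t - s).
  rewrite nrmM.
  have -> : e / 3 * (t - s) = e / 3 / T * (t - s) * T by field; rewrite gt_eqF.
  by rewrite ler_pM ?nrm_ge0 ?h3 ?hT// (le_trans st).
have b3 : nrm ((t - s)%:C *: (l * k x * (Th s - Th x) : R[i]^o)) <= e / 3 * (t - s).
  rewrite nrmZr_ge0// mulrC ler_wpM2r// !nrmM.
  have -> : e / 3 = nl * Q * (e / 3 / (nl * Q)) by field; rewrite !gt_eqF.
  rewrite ler_pM ?mulr_ge0 ?nrm_ge0//.
    by rewrite ler_pM ?nrm_ge0// ?lerDl// hQ ?(le_trans s0)// (le_trans xt).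
  by rewrite nrmBC h4 ?(le_trans xt)//; lra.
rewrite (le_trans (nrmD _ _))//; have := nrmB (P t - P s - k t * (Th t - Th s) : R[i]^o)
  ((k t - k s - (t - s)%:C *: (- l *: k x)) * Th s); lra.
Qed.

End ThetaLaplace.

Section ThetaTransform.
Context (R : realType) (K : R -> R[i]) (hK : L1loc K) (beta : R).
Hypothesis hbeta : forall l : R[i], beta < complex.Re l -> laplace_ex K l.
Implicit Types l : R[i].

Lemma laplace_cvg l : beta < complex.Re l ->
  cvg_pinfty (laplace_partial K l) (laplace K l : R[i]^o).
Proof. by move=> /hbeta hl; apply/cvg_pinftyP. Qed.

(** Convergence of K~(k) bounds the partial integrals P by some B. Let H be the primitive of
    exp(-kt) Theta(t) with H(0) = 0. Then P = kH + H', so exp(kt)H has derivative exp(kt)P, which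
    gives |H| <= B / k and thus |exp(-kt) Theta(t)| = |P - kH| <= 2B. *)
Lemma Theta_exp_bound (k : R) : 0 < k -> beta < k ->
  exists c, forall t, 0 <= t -> nrm (Theta K t : R[i]^o) <= c * expR (k * t).
Proof.
move=> k0 bk.
set P : R -> R[i]^o := laplace_partial K k%:C.
pose H (t : R) : R[i]^o := (k^-1)%:C * (P t - exp_ker k%:C t * Theta K t).
have PH : is_prim (fun t => exp_ker k%:C t * Theta K t : R[i]^o) H.
  have := primZ (k^-1)%:C (prim_laplace_partial hK k%:C).
  apply: eq_prim => t _ //; rewrite /GRing.scale/= mulrA -rmorphM/= mulVf ?gt_eqF//.
  by rewrite mul1r.
have PE t : P t = k%:C * H t + exp_ker k%:C t * Theta K t.
  rewrite /H mulrA -rmorphM/= mulfV ?gt_eqF// mul1r.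
  by rewrite subrK.
have H0 : H 0 = 0 by rewrite /H /P laplace_partial0 Theta0 mulr0 subrr mulr0.
have cP : ucont P.
  apply: (@eq_ucont _ _ (fun t => k%:C *: H t + exp_ker k%:C t * Theta K t)).
    by move=> t _; rewrite PE.
  by apply: ucont_lin; [exact: prim_prim_ucont PH|exact: prim_ucont PH].
have [B B0 hB] : exists2 B : R, 0 < B & forall t, 0 <= t -> nrm (P t) <= B.
  have [T T0 hT] := @laplace_cvg k%:C bk 1 ltr01.
  have [M M0 hM] := ucont_bounded cP T0.
  exists (M + (nrm (laplace K k%:C : R[i]^o) + 1)).
    by rewrite addr_gt0// ltr_wpDl// nrm_ge0.
  move=> t t0; have [tT|Tt] := leP t T.
    by rewrite (le_trans (hM t t0 tT))// lerDl addr_ge0// nrm_ge0.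
  have := hT t (ltW Tt); rewrite -/(P t) => h.
  rewrite -[P t](subrK (laplace K k%:C : R[i]^o)) (le_trans (nrmD _ _))//; lra.
have HB t : 0 <= t -> nrm (H t) <= B / k.
  move=> t0.
  have kk (s : R) : nrm (exp_ker (- k)%:C s) = expR (k * s) by rewrite nrm_ker/= opprK.
  have PkH := prim_scale (prim_ker (- k)%:C) PH.
  have := @prim_bound_expR _ _ _ _ B k 0 t (lexx _) t0 (lt0r_neq0 k0) PkH.
  rewrite H0 scaler0 subr0 nrmZ kk mulr0 expR0 => H1.
  have {}H1 : expR (k * t) * nrm (H t) <= B / k * (expR (k * t) - 1).
    apply: H1 => s s0 _.
    have -> : - (- k)%:C *: exp_ker (- k)%:C s *: H s
       + exp_ker (- k)%:C s *: (exp_ker k%:C s * Theta K s : R[i]^o) = exp_ker (- k)%:C s * P s.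
      by rewrite PE /GRing.scale/= rmorphN opprK; ring.
    by rewrite nrmM kk mulrC ler_wpM2r ?expR_ge0// hB.
  rewrite -(ler_pM2l (expR_gt0 (k * t))) (le_trans H1)// mulrC.
  by rewrite ler_wpM2r ?divr_ge0 ?(ltW B0) ?(ltW k0)//; lra.
exists (B + B) => t t0.
have : nrm (exp_ker k%:C t * Theta K t : R[i]^o) <= B + B.
  have -> : exp_ker k%:C t * Theta K t = P t - k%:C *: H t.
    by rewrite PE [X in X - _]addrC addrK.
  rewrite (le_trans (nrmB _ _))// lerD ?hB// nrmZr_ge0 ?(ltW k0)//.
  by rewrite -ler_pdivlMl// mulrC HB.
rewrite nrmM nrm_ker/= mulNr expRN.
by rewrite ler_pdivrMl ?expR_gt0// mulrC.
Qed.

Lemma Theta_laplace (E : completeNormedModType R[i]) (y : E) l :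
  0 < complex.Re l -> beta < complex.Re l ->
  has_laplace (fun t => Theta K t *: y) l ((laplace K l / l) *: y).
Proof.
move=> l0 bl.
have ln0 : l != 0 by apply: contraTneq l0 => ->; rewrite ltxx.
pose k := (Num.max 0 beta + complex.Re l) / 2.
have ml : Num.max 0 beta < complex.Re l by rewrite gt_max l0.
have k0 : 0 < k.
  have m0 : 0 <= Num.max 0 beta by rewrite le_max lexx.
  by rewrite /k; lra.
have bk : beta < k.
  have m0 : beta <= Num.max 0 beta by rewrite le_max lexx orbT.
  by rewrite /k; lra.
have kl : k < complex.Re l by rewrite /k; lra.
have [c hc] := Theta_exp_bound k0 bk.
(* [W] is l times the integral of exp(-ls) Theta(s) over [0, t], and it tends to K~(l) because its
   second term vanishes at infinity. *)
pose W (t : R) : R[i]^o := laplace_partial K l t - exp_ker l t * Theta K t.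
have PW : is_prim _ W := prim_laplace_partial hK l.
exists (fun t => l^-1 *: (W t *: y)); split.
- have := primZ l^-1 (prim_scale PW (prim_cst y)).
  apply: eq_prim => t _ //.
  by rewrite scaler0 addr0 !scalerA mulKf.
- by rewrite /W laplace_partial0 Theta0 mulr0 subrr scale0r scaler0.
- have c0 := exp_bound_ge0 hc.
  have kT : cvg_pinfty (fun t => exp_ker l t * Theta K t : R[i]^o) 0.
    move=> e e0; have lk0 : 0 < complex.Re l - k by rewrite subr_gt0.
    have c1 : 0 < c + 1 by rewrite ltr_wpDl.
    have [B B0 h] := expRN_small lk0 (divr_gt0 e0 c1).
    exists B => // b Bb; rewrite subr0.
    have := @nrm_ker_scale R R[i]^o _ _ _ l hc _ (le_trans B0 Bb).
    move=> /le_trans; apply.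
    rewrite (le_trans (ler_wpM2l _ (h _ Bb)))//.
    by rewrite mulrCA ler_piMr ?(ltW e0)// ler_pdivrMr// mul1r lerDl.
  have := cvg_pinfty_lin (-1) kT (laplace_cvg bl).
  rewrite scaler0 add0r => Wv e e0.
  pose n := nrm (l^-1 : R[i]^o) * nrm y + 1.
  have n0 : 0 < n by rewrite ltr_wpDl// mulr_ge0// nrm_ge0.
  have [B B0 h] := Wv _ (divr_gt0 e0 n0).
  exists B => // b Bb.
  have -> : l^-1 *: (W b *: y) - laplace K l / l *: y =
     (l^-1 * (W b - laplace K l)) *: y.
    by rewrite scalerA -scalerBl (mulrBr _ (W b)) [laplace K l / l]mulrC.
  rewrite nrmZ nrmM mulrAC -[e](divfK (lt0r_neq0 n0)) [leRHS]mulrC.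
  rewrite ler_pM ?mulr_ge0 ?nrm_ge0 ?lerDl//.
  by have := h b Bb; rewrite scaleN1r [X in X - _]addrC.
Qed.

End ThetaTransform.

Lemma Theta_eq0 (R : realType) (K : R -> R[i]) : L1loc K ->
  (forall t, 0 <= t -> Theta K t = 0) -> L1loc_zero K.
Proof.
move=> hK T0.
have r0 : forall t, 0 <= t -> primint (fun x => complex.Re (K x)) t = 0.
  by move=> t /T0 /eqP; rewrite eq_complex => /andP[/eqP].
have i0 : forall t, 0 <= t -> primint (fun x => complex.Im (K x)) t = 0.
  by move=> t /T0 /eqP; rewrite eq_complex => /andP[_ /eqP].
have iKr : locint (fun x => complex.Re (K x)) by move=> b b0; have [] := hK b b0.
have iKi : locint (fun x => complex.Im (K x)) by move=> b b0; have [] := hK b b0.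
move: (primint_eq0 iKr r0) (primint_eq0 iKi i0).
apply: filterS2; first exact: (ae_filter_ringOfSetsType lebesgue_measure).
move=> t hr hi t0; apply/eqP; rewrite eq_complex; apply/andP; split; apply/eqP.
  exact: hr.
exact: hi.
Qed.

(** * Inversion of the Laplace transform *)

Section Kernel.
Context (R : realType).
Implicit Types (u : R) (n : nat).

(** Bernoulli's inequality. For u = exp(-ls) and n = exp(lt) it bounds the inversion kernel by
    exp(l(t - s)), which is useful for s > t. *)
Lemma one_sub_exp_le u n : 0 <= u -> u <= 1 -> 1 - (1 - u) ^+ n <= n%:R * u.
Proof.
move=> u0 u1; elim: n => [|n IH]; first by rewrite expr0 subrr mul0r.
have : (1 - u) ^+ n <= 1 by rewrite exprn_ile1//; lra.
rewrite exprS -natr1; nra.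
Qed.

(** The counterpart for s < t: the defect of the kernel from 1 is at most exp(l(s - t)). *)
Lemma exp_one_sub_le u n : 0 <= u -> u <= 1 -> (1 - u) ^+ n * (n%:R * u) <= 1.
Proof.
move=> u0 u1.
(* The form that passes through the induction, as (1 - u)(1 + (n + 1)u) <= 1 + nu. *)
suff H : (1 - u) ^+ n * (1 + n%:R * u) <= 1.
  have : 0 <= (1 - u) ^+ n by rewrite exprn_ge0//; lra.
  move: H; lra.
elim: n => [|n IH]; first by rewrite expr0 mul0r addr0 mulr1.
apply: le_trans IH; rewrite exprSr -mulrA ler_wpM2l ?exprn_ge0//; first by lra.
rewrite -natr1; have : 0 <= (n%:R : R) by []; nra.
Qed.

End Kernel.

Section Inversion.
Context (R : realType) (E : completeNormedModType R[i]).
Implicit Types (f g F G : R -> E).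

(* With exp(lt) = n, the kernel 1 - (1 - exp(-ls))^n is close to 1 for s < t and
   to 0 for s > t. *)
Lemma inversion_kernel_bound f F v (B k l t : R) n : 0 < k -> k < l -> 0 < t ->
    expR (l * t) = n%:R -> is_prim f F -> F 0 = 0 ->
    (forall s, 0 <= s -> nrm (f s) <= B * expR (k * s)) ->
  improper_int (fun s => (1 - (1 - expR (- l * s)) ^+ n)%:C *: f s) v ->
  nrm (v - F t) <= 2 * (B * expR (k * t)) / (l - k).
Proof.
move=> k0 kl t0 lt fF F0 fB [G [fG G0 Gv]].
have l0 : 0 < l := lt_trans k0 kl.
have B0 := exp_bound_ge0 fB.
have n0 : 0 < (n%:R : R) by rewrite -lt expR_gt0.
have lk0 : 0 < l - k by rewrite subr_gt0.
have u1 s : 0 <= s -> expR (- l * s) <= 1.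
  by move=> s0; rewrite -expR0 ler_expR mulNr oppr_le0 mulr_ge0// ltW.
have p0 s : 0 <= s -> 0 <= (1 - expR (- l * s)) ^+ n.
  by move=> s0; rewrite exprn_ge0// subr_ge0 u1.
have p1 s : 0 <= s -> (1 - expR (- l * s)) ^+ n <= 1.
  by move=> s0; rewrite exprn_ile1// ?subr_ge0 ?u1// gerBl expR_ge0.
have tail : nrm (v - G t) <= B * expR (k * t) / (l - k).
  (* The factor n from Bernoulli's inequality equals exp(lt) and cancels exactly the decay exp(-lt)
     of the tail. *)
  have -> : B * expR (k * t) / (l - k) = n%:R * B / (l - k) * expR (- (l - k) * t).
    rewrite -lt; have -> : - (l - k) * t = k * t + - (l * t) by ring.
    rewrite expRD expRN; field.
    by rewrite !gt_eqF ?expR_gt0// subr_gt0.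
  apply: (improper_int_tail (ltW t0) lk0 fG Gv) => s ts; have s0 := le_trans (ltW t0) ts.
  rewrite nrmZr_ge0 ?subr_ge0 ?p1//.
  have -> : - (l - k) * s = - l * s + k * s by ring.
  rewrite expRD.
  have h := one_sub_exp_le n (expR_ge0 (- l * s)) (u1 s s0).
  have h0 : 0 <= 1 - (1 - expR (- l * s)) ^+ n by rewrite subr_ge0 p1.
  apply: (le_trans (ler_pM h0 (nrm_ge0 (f s)) h (fB s s0))).
  by rewrite le_eqVlt; apply/orP; left; apply/eqP; ring.
have head : nrm (G t - F t) <= B * expR (k * t) / l.
  have := prim_bound_expR (lexx _) (ltW t0) (lt0r_neq0 l0) (primB fG fF).
  move=> /(_ (B * expR (k * t) / n%:R)); rewrite G0 F0 subrr subr0 mulr0 expR0 lt => h.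
  apply: (le_trans (h _)); last first.
    rewrite -[leRHS]mulr1 -!mulrA ler_wpM2l// ler_wpM2l ?expR_ge0//.
    rewrite mulrCA ler_wpM2l ?invr_ge0 ?(ltW l0)//.
    by rewrite ler_pdivrMl// mulr1 gerBl.
  move=> s s0 st.
  have -> : (1 - (1 - expR (- l * s)) ^+ n)%:C *: f s - f s =
      - ((1 - expR (- l * s)) ^+ n)%:C *: f s.
    by vector_identity (R[i]) [:: f s]; ring.
  rewrite scaleNr nrmN nrmZr_ge0 ?p0//.
  have h1 : (1 - expR (- l * s)) ^+ n <= expR (l * s) / n%:R.
    rewrite ler_pdivlMr// -[leRHS]mulr1 -ler_pdivrMl ?expR_gt0// mulrC -expRN -mulNr -mulrA.
    by apply: exp_one_sub_le; [exact: expR_ge0|exact: u1].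
  have h2 : nrm (f s) <= B * expR (k * t).
    by rewrite (le_trans (fB s s0))// ler_wpM2l// ler_expR ler_wpM2l// ltW.
  apply: (le_trans (ler_pM (p0 s s0) (nrm_ge0 _) h1 h2)).
  by rewrite le_eqVlt; apply/orP; left; apply/eqP; ring.
have hl : B * expR (k * t) / l <= B * expR (k * t) / (l - k).
  rewrite ler_wpM2l ?mulr_ge0 ?expR_ge0// lef_pV2 ?posrE//.
  by rewrite gerBl ltW.
rewrite (le_trans (nrm_tri (G t) _ _))//.
by move: tail head hl; rewrite mulrDl mul1r mulrDl; lra.
Qed.

Context (P : E -> E -> Prop) (hP : closed_relation P).

Lemma inversion_kernel_rel f g (k l : R) : 0 < l -> k < l ->
    (forall r, k < r -> exists v w,
      [/\ has_laplace f r%:C v, has_laplace g r%:C w & P v w]) ->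
  forall n, exists v w,
    [/\ improper_int (fun s => (1 - (1 - expR (- l * s)) ^+ n)%:C *: f s) v,
        improper_int (fun s => (1 - (1 - expR (- l * s)) ^+ n)%:C *: g s) w & P v w].
Proof.
move=> l0 kl hfg.
(* With u = exp(-ls), expand u^(j+1) (1 - u)^n one factor at a time. The exponent of u stays at
   least 1, so only transforms at multiples of l, all beyond k, occur. *)
have H n j : exists v w,
    [/\ improper_int (fun s => (expR (- l * s) ^+ j.+1 * (1 - expR (- l * s)) ^+ n)%:C *: f s) v,
        improper_int (fun s => (expR (- l * s) ^+ j.+1 * (1 - expR (- l * s)) ^+ n)%:C *: g s) w
      & P v w].
  elim: n j => [|n IH] j.
    have kj : k < j.+1%:R * l.
      by rewrite (lt_le_trans kl)// ler_peMl ?ler1n// ltW.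
    have [v [w [fv gw vw]]] := hfg _ kj; exists v, w.
    have kE s : exp_ker (j.+1%:R * l)%:C s =
        (expR (- l * s) ^+ j.+1 * (1 - expR (- l * s)) ^+ 0)%:C.
      rewrite ker_real expr0 mulr1 -expRM_natl; congr (expR _)%:C; ring.
    by split => //; [apply: eq_improper_int fv|apply: eq_improper_int gw] => s _; rewrite kE.
  have [v [w [fv gw vw]]] := IH j; have [v' [w' [fv' gw' vw']]] := IH j.+1.
  exists (v - v'), (w - w'); split.
  - apply: eq_improper_int (improper_intB fv fv') => s _.
    by rewrite -scalerBl -rmorphB/=; congr (_%:C *: _); rewrite [in RHS]exprS !exprS; ring.
  - apply: eq_improper_int (improper_intB gw gw') => s _.
    by rewrite -scalerBl -rmorphB/=; congr (_%:C *: _); rewrite [in RHS]exprS !exprS; ring.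
  - have := closed_relationD hP vw (closed_relationZ hP (-1) vw').
    by rewrite !scaleN1r.
elim=> [|n [v [w [fv gw vw]]]].
  exists 0, 0; split; [| |by case: hP].
  - by apply: eq_improper_int (improper_int0 _) => s _; rewrite expr0 subrr scale0r.
  - by apply: eq_improper_int (improper_int0 _) => s _; rewrite expr0 subrr scale0r.
(* 1 - (1 - u)^(n+1) exceeds 1 - (1 - u)^n by u(1 - u)^n. *)
have [v' [w' [fv' gw' vw']]] := H n 0%N.
exists (1 *: v + v'), (1 *: w + w'); split.
- apply: eq_improper_int (improper_int_lin 1 fv fv') => s _.
  by rewrite scale1r -scalerDl -rmorphD/=; congr (_%:C *: _); rewrite [in RHS]exprS; ring.
- apply: eq_improper_int (improper_int_lin 1 gw gw') => s _.
  by rewrite scale1r -scalerDl -rmorphD/=; congr (_%:C *: _); rewrite [in RHS]exprS; ring.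
- by case: hP => _ + _; apply.
Qed.

Lemma laplace_inversion f g (B k : R) : 0 < k -> ucont f -> ucont g ->
    (forall s, 0 <= s -> nrm (f s) <= B * expR (k * s)) ->
    (forall s, 0 <= s -> nrm (g s) <= B * expR (k * s)) ->
    (forall r, k < r -> exists v w,
      [/\ has_laplace f r%:C v, has_laplace g r%:C w & P v w]) ->
  forall t, 0 <= t -> P (f t) (g t).
Proof.
move=> k0 cf cg fB gB hfg.
have [F fF F0] := prim_exists cf; have [G gG G0] := prim_exists cg.
have B0 := exp_bound_ge0 fB.
have PFG t : 0 <= t -> P (F t) (G t).
  rewrite le_eqVlt => /predU1P[<-|t0]; first by rewrite F0 G0; case: hP.
  case: (hP) => _ _; apply => e e0.
  pose c := 2 * (B * expR (k * t)) / e.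
  have c0 : 0 <= c by rewrite divr_ge0 ?mulr_ge0 ?expR_ge0// ltW.
  (* n must be an integer, so n is chosen first and l = ln(n) / t afterwards. The size of n gives l
     - k > c, and c is what brings the inversion error below e. *)
  pose n := Num.bound (expR (t * (k + c + 1))).
  have nE : expR (t * (k + c + 1)) < n%:R by rewrite archi_boundP ?expR_ge0.
  have n0 : 0 < (n%:R : R) by rewrite (lt_trans _ nE) ?expR_gt0.
  pose l := ln (n%:R : R) / t.
  have lt : expR (l * t) = n%:R by rewrite /l divfK ?gt_eqF// lnK.
  have lc : k + c + 1 < l.
    by rewrite /l ltr_pdivlMr// -ltr_expR lnK ?posrE// mulrC.
  have kl : k < l by lra.
  have [v [w [fv gw vw]]] := inversion_kernel_rel (lt_trans k0 kl) kl hfg n.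
  have ce : 2 * (B * expR (k * t)) / (l - k) <= e.
    rewrite ler_pdivrMr ?subr_gt0// -ler_pdivrMl// [leLHS]mulrC -/c; lra.
  exists v, w; split => //; rewrite nrmBC.
    exact: le_trans (inversion_kernel_bound k0 kl t0 lt fF F0 fB fv) ce.
  exact: le_trans (inversion_kernel_bound k0 kl t0 lt gG G0 gB gw) ce.
move=> t t0; case: (hP) => _ _; apply => e e0.
have t10 : 0 <= t + 1 by rewrite addr_ge0.
have [d d0 h] := fF _ _ t10 e0; have [d' d'0 h'] := gG _ _ t10 e0.
pose m := Num.min (Num.min d d' / 2) 1.
have m0 : 0 < m by rewrite lt_min ltr01 andbT divr_gt0// lt_min d0 d'0.
have md : m < d /\ m < d'.
  have : m <= Num.min d d' / 2 by rewrite ge_min lexx.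
  have : Num.min d d' <= d by rewrite ge_min lexx.
  have : Num.min d d' <= d' by rewrite ge_min lexx orbT.
  move: d0 d'0; split; lra.
have m1 : m <= 1 by rewrite ge_min lexx orbT.
have mC : (m%:C : R[i]) != 0 by rewrite -[0]/(0%:C) (inj_eq (@complexI _)) gt_eqF.
have tm : t <= t + m by rewrite lerDl ltW.
have tme : t + m - t = m by rewrite addrC addKr.
exists (m^-1%:C *: (F (t + m) - F t)), (m^-1%:C *: (G (t + m) - G t)); split.
- apply: closed_relationZ => //; rewrite -[- F t]scaleN1r -[- G t]scaleN1r.
  apply: closed_relationD => //; first by apply: PFG; exact: le_trans tm.
  by apply: closed_relationZ => //; exact: PFG.
- rewrite nrmBC; have := h t t (t + m) t0 (lexx _) tm.
  rewrite lerD2l tme => /(_ m1 md.1) hh.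
  have -> : m^-1%:C *: (F (t + m) - F t) - f t =
     m^-1%:C *: (F (t + m) - F t - m%:C *: f t).
    by rewrite [RHS]scalerBr scalerA -rmorphM/= mulVf ?gt_eqF// scale1r.
  rewrite nrmZr_ge0 ?invr_ge0 ?(ltW m0)//.
  by rewrite ler_pdivrMl// mulrC.
- rewrite nrmBC; have := h' t t (t + m) t0 (lexx _) tm.
  rewrite lerD2l tme => /(_ m1 md.2) hh.
  have -> : m^-1%:C *: (G (t + m) - G t) - g t =
     m^-1%:C *: (G (t + m) - G t - m%:C *: g t).
    by rewrite [RHS]scalerBr scalerA -rmorphM/= mulVf ?gt_eqF// scale1r.
  rewrite nrmZr_ge0 ?invr_ge0 ?(ltW m0)//.
  by rewrite ler_pdivrMl// mulrC.
Qed.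

End Inversion.

(** * Zeros of the Laplace transform *)

Section Uniqueness.
Context (R : realType) (E : completeNormedModType R[i]).
Implicit Types (f g h : R -> E).

Let sub_exp_le (x y : R) m : `|x| <= 1 -> `|y| <= 1 ->
  `|x ^+ m - y ^+ m| <= m%:R * `|x - y|.
Proof.
move=> x1 y1; elim: m => [|m IH]; first by rewrite subrr normr0 mul0r.
have -> : x ^+ m.+1 - y ^+ m.+1 = x * (x ^+ m - y ^+ m) + (x - y) * y ^+ m.
  by rewrite !exprS; ring.
have -> : m.+1%:R * `|x - y| = m%:R * `|x - y| + `|x - y| by rewrite -natr1; ring.
rewrite (le_trans (ler_normD _ _))// !normrM lerD//.
  by rewrite (le_trans _ IH)// ler_piMl.
by rewrite ler_piMr// normrX exprn_ile1.
Qed.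

Let lin_le_expR (c s : R) : 0 < c -> 0 <= s -> s <= c^-1 * expR (c * s).
Proof.
move=> c0 s0; rewrite ler_pdivlMl// (le_trans _ (expR_ge1Dx _))//; lra.
Qed.

Let sqr_le_expR (c s : R) : 0 < c -> 0 <= s -> s ^+ 2 <= 4 / c ^+ 2 * expR (c * s).
Proof.
move=> c0 s0; have c20 : 0 < c / 2 by rewrite divr_gt0.
have h := lin_le_expR c20 s0.
have -> : 4 / c ^+ 2 * expR (c * s) = ((c / 2)^-1 * expR (c / 2 * s)) ^+ 2.
  have -> : c * s = c / 2 * s + c / 2 * s by field.
  by rewrite expRD; field; rewrite gt_eqF.
by rewrite ler_sqr ?nnegrE// mulr_ge0 ?expR_ge0// invr_ge0 ltW.
Qed.

(* exp(-2x) - (2 exp(-x) - 1) = (1 - exp(-x))^2 is of second order, so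
   exp(-(a + 2L)s) is approximated by exp(-as) (2 exp(-Ls/m) - 1)^m, a
   combination of exponentials with exponents in [a, a + L]. *)
Lemma laplace_eq0_extend h (B k a L : R) : ucont h ->
    (forall s, 0 <= s -> nrm (h s) <= B * expR (k * s)) ->
    k < a -> 0 < L ->
    (forall r, a <= r -> r <= a + L -> has_laplace h r%:C 0) ->
  has_laplace h (a + 2 * L)%:C 0.
Proof.
move=> ch hB ka L0 h0.
have B0 := exp_bound_ge0 hB.
have kaL : k < complex.Re (a + 2 * L)%:C by rewrite /=; lra.
have [v hv] := has_laplace_exists ch kaL hB.
suff -> : 0 = v by [].
apply/esym; apply: nrm_le_small => e e0.
(* One half of the gap between a and k absorbs the factor s^2 of the error, the other half makes the
   error integrable. *)
pose c := (a - k) / 2.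
have c0 : 0 < c by rewrite divr_gt0// subr_gt0.
pose D := L ^+ 2 * (4 / c ^+ 2) * B / c.
have D0 : 0 <= D by rewrite divr_ge0 ?(ltW c0)// mulr_ge0// mulr_ge0 ?sqr_ge0// divr_ge0 ?sqr_ge0.
pose m := (Num.bound (D / e)).+1.
have m0 : 0 < (m%:R : R) by [].
have Dm : D / m%:R <= e.
  rewrite ler_pdivrMr// -ler_pdivrMl// mulrC.
  by rewrite ltW// (lt_trans (archi_boundP (divr_ge0 D0 (ltW e0))))// ltr_nat.
apply: le_trans Dm.
pose d := L / m%:R; pose u s := expR (- d * s).
have d0 : 0 < d by rewrite divr_gt0.
have dm : m%:R * d = L by rewrite mulrC divfK// gt_eqF.
(* Induction on i by (2u - 1)^(i+1) u^j = 2 u^(j+1) (2u - 1)^i - u^j (2u - 1)^i; the condition on i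
   + j keeps all exponents in [a, a + L], since md = L. *)
have H i j : (i + j <= m)%N ->
    improper_int (fun s => (expR (- a * s) * u s ^+ j * (2 * u s - 1) ^+ i)%:C *: h s) 0.
  elim: i j => [|i IH] j ijm.
    apply: eq_improper_int (h0 (a + j%:R * d) _ _).
    - move=> s _; rewrite ker_real expr0 mulr1 /u -expRM_natl -expRD.
      by congr ((expR _)%:C *: _); ring.
    - by rewrite lerDl mulr_ge0// ltW.
    - by rewrite lerD2l -dm ler_wpM2r ?(ltW d0)// ler_nat.
  have ijm' : (i + j <= m)%N by rewrite (leq_trans _ ijm)// addSn.
  have ijm'' : (i + j.+1 <= m)%N by rewrite addnS -addSn.
  have := improper_intB (improper_intZ 2%:C (IH j.+1 ijm'')) (IH j ijm').
  rewrite scaler0 subrr; apply: eq_improper_int => s _.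
  by rewrite scalerA -rmorphM -scalerBl -rmorphB/=; congr (_%:C *: _); rewrite !exprS; ring.
have hm : improper_int (fun s => (expR (- a * s) * (2 * u s - 1) ^+ m)%:C *: h s) 0.
  by apply: eq_improper_int (H m 0%N _); [move=> s _; rewrite expr0 mulr1|rewrite addn0].
have := improper_intB hv hm; rewrite subr0.
have -> : D / m%:R = (L ^+ 2 / m%:R * (4 / c ^+ 2) * B) / c.
  by rewrite /D; field; rewrite !gt_eqF.
apply: improper_int_bound => // s s0.
have u0 : 0 <= u s by exact: expR_ge0.
have u1 : u s <= 1.
  by rewrite /u -expR0 ler_expR mulNr oppr_le0 mulr_ge0// ltW.
have ker_u : expR (- (a + 2 * L) * s) = expR (- a * s) * (u s ^+ 2) ^+ m.
  rewrite /u -!expRM_natl -expRD; congr expR; rewrite -dm; ring.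
rewrite ker_real -scalerBl -rmorphB/= ker_u -mulrBr nrmZr normrM ger0_norm ?expR_ge0//.
have n1 : `|u s ^+ 2| <= 1 by rewrite ger0_norm ?exprn_ge0// exprn_ile1.
have n2 : `|2 * u s - 1| <= 1 by rewrite ler_norml; apply/andP; split; lra.
have us : 1 - u s <= d * s.
  by have := expR_ge1Dx (- d * s); rewrite -/(u s); lra.
(* The bases differ by (1 - u)^2 <= (ds)^2 and the powers by at most m times that. As d = L / m, one
   factor 1 / m is left over. *)
have n3 : `|(u s ^+ 2) ^+ m - (2 * u s - 1) ^+ m| <= L ^+ 2 / m%:R * s ^+ 2.
  apply: le_trans (sub_exp_le m n1 n2) _.
  have -> : u s ^+ 2 - (2 * u s - 1) = (1 - u s) ^+ 2 by ring.
  have -> : L ^+ 2 / m%:R * s ^+ 2 = m%:R * (d * s) ^+ 2.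
    by rewrite /d; field; rewrite gt_eqF.
  rewrite ler_wpM2l// ger0_norm ?sqr_ge0// ler_sqr ?nnegrE ?subr_ge0//.
  by rewrite mulr_ge0// ltW.
have n4 : `|(u s ^+ 2) ^+ m - (2 * u s - 1) ^+ m| <=
    L ^+ 2 / m%:R * (4 / c ^+ 2 * expR (c * s)).
  apply: le_trans n3 _; rewrite ler_wpM2l ?sqr_le_expR//.
  by rewrite divr_ge0// sqr_ge0.
have := ler_pM (normr_ge0 _) (nrm_ge0 _) n4 (hB s s0).
move=> /(ler_wpM2l (expR_ge0 (- a * s))); rewrite mulrA => /le_trans; apply.
have -> : - c * s = - a * s + c * s + k * s by rewrite /c; field.
by rewrite !expRD le_eqVlt; apply/orP; left; apply/eqP; ring.
Qed.

Lemma laplace_eq0_interval h (B k a L : R) : 0 < a -> ucont h ->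
    (forall s, 0 <= s -> nrm (h s) <= B * expR (k * s)) ->
    k < a -> 0 < L ->
    (forall r, a <= r -> r <= a + L -> has_laplace h r%:C 0) ->
  forall t, 0 <= t -> h t = 0.
Proof.
move=> a0 ch hB ka L0 h0.
have B0 := exp_bound_ge0 hB.
have H n r : a <= r -> r <= a + L *+ 2 ^ n -> has_laplace h r%:C 0.
  elim: n r => [|n IH] r ar rL; first exact: h0.
  have [->|rna] := eqVneq r a; first by apply: h0; rewrite ?lerDl// ltW.
  (* The extension is applied with length (r - a) / 2, which lies within the previous interval; each
     round doubles the interval of zeros. *)
  have -> : r = a + 2 * ((r - a) / 2) by field.
  have ra : 0 < r - a by rewrite subr_gt0 lt_neqAle eq_sym rna.
  apply: (laplace_eq0_extend ch hB ka) => [|q aq qr]; first by rewrite divr_gt0.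
  apply: IH => //; move: rL; rewrite expnS mulnC mulrnA; lra.
have Hall r : a < r -> has_laplace h r%:C 0.
  move=> ar; pose n := Num.bound ((r - a) / L).
  apply: (H n); first exact: ltW.
  have rn : (r - a) / L < n%:R.
    by rewrite archi_boundP// divr_ge0// ?subr_ge0 ltW.
  rewrite -lerBlDl -mulr_natr mulrC -ler_pdivrMr//.
  by rewrite (le_trans (ltW rn))// ler_nat ltnW// ltn_expl.
have z0 : ucont (fun=> 0 : E) by exact: ucont_cst.
have hBa s : 0 <= s -> nrm (h s) <= B * expR (a * s).
  move=> s0; rewrite (le_trans (hB s s0))// ler_wpM2l// ler_expR ler_wpM2r//.
  exact: ltW.
apply: (laplace_inversion (@eq_closed_relation R E) a0 ch z0 hBa).
  by move=> s s0; rewrite nrm0 mulr_ge0 ?expR_ge0.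
move=> r ar; exists 0, 0; split => //; first exact: Hall.
by apply: eq_improper_int (improper_int0 _) => s _; rewrite scaler0.
Qed.

(** Continuity from the right is enough, because nonzeros of K~ are sought to the right of a given
    point. *)
Lemma laplace_right_continuous f (B k r0 e : R) :
    (forall s, 0 <= s -> nrm (f s) <= B * expR (k * s)) -> k < r0 -> 0 < e ->
  exists2 d : R, 0 < d & forall r v v0, r0 <= r -> r <= r0 + d ->
    has_laplace f r%:C v -> has_laplace f r0%:C v0 -> nrm (v - v0) <= e.
Proof.
move=> fB kr e0.
have B0 := exp_bound_ge0 fB.
pose c := (r0 - k) / 2.
have c0 : 0 < c by rewrite divr_gt0// subr_gt0.
pose D := c^-1 * B / c.
have D0 : 0 <= D by rewrite !mulr_ge0 ?invr_ge0// ltW.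
have D1 : 0 < D + 1 by rewrite ltr_wpDl.
exists (e / (D + 1)); first by rewrite divr_gt0.
move=> r v v0 r0r rd fv fv0.
have rD : (r - r0) * c^-1 * B / c <= e.
  have -> : (r - r0) * c^-1 * B / c = (r - r0) * D by rewrite /D; ring.
  have : r - r0 <= e / (D + 1) by lra.
  move=> /(ler_wpM2r D0) /le_trans; apply.
  by rewrite mulrAC ler_pdivrMr// ler_pM2l//; lra.
apply: le_trans rD; apply: (improper_int_bound c0 _ (improper_intB fv fv0)) => s s0.
rewrite !ker_real -scalerBl -rmorphB/= nrmZr.
have x0 : 0 <= (r - r0) * s by rewrite mulr_ge0// subr_ge0.
have h1 : `|expR (- r * s) - expR (- r0 * s)| <=
    expR (- r0 * s) * ((r - r0) * (c^-1 * expR (c * s))).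
  have -> : - r * s = - r0 * s + - ((r - r0) * s) by ring.
  rewrite expRD -[X in _ * _ - X]mulr1 -mulrBr normrM ger0_norm ?expR_ge0//.
  rewrite ler_wpM2l ?expR_ge0//.
  have : (r - r0) * s <= (r - r0) * (c^-1 * expR (c * s)).
    by rewrite ler_wpM2l ?subr_ge0// lin_le_expR.
  apply: le_trans; rewrite distrC ger0_norm ?subr_ge0.
    by have := expR_ge1Dx (- ((r - r0) * s)); lra.
  by rewrite -expR0 ler_expR oppr_le0.
apply: le_trans (ler_pM (normr_ge0 _) (nrm_ge0 _) h1 (fB s s0)) _.
have -> : - c * s = - r0 * s + c * s + k * s by rewrite /c; field.
by rewrite !expRD le_eqVlt; apply/orP; left; apply/eqP; ring.
Qed.

Context (K : R -> R[i]) (hK : L1loc K) (K_neq0 : ~ L1loc_zero K) (beta : R).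
Hypothesis hbeta : forall l : R[i], beta < complex.Re l -> laplace_ex K l.

Lemma laplace_neq0_dense (y : E) (r0 e : R) : y != 0 -> 0 < r0 -> beta < r0 -> 0 < e ->
  exists r, [/\ r0 <= r, r <= r0 + e & laplace K r%:C != 0].
Proof.
move=> y0 r00 br0 e0; apply: contrapT => /forallNP hr.
apply: K_neq0; apply: Theta_eq0 => // t t0.
(* A growth rate for Theta strictly below r0. The scalar function Theta is made E-valued by a
   nonzero vector y, so a zero of Theta y is one of Theta. *)
pose k := (Num.max 0 beta + r0) / 2.
have ml : Num.max 0 beta < r0 by rewrite gt_max r00.
have k0 : 0 < k.
  have m0 : 0 <= Num.max 0 beta by rewrite le_max lexx.
  by rewrite /k; lra.
have bk : beta < k.
  have m0 : beta <= Num.max 0 beta by rewrite le_max lexx orbT.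
  by rewrite /k; lra.
have kl : k < r0 by rewrite /k; lra.
have [c hc] := Theta_exp_bound hK hbeta k0 bk.
have cTy : ucont (fun t => Theta K t *: y).
  by apply: ucont_scale; [exact: Theta_ucont|exact: ucont_cst].
have Tyb s : 0 <= s -> nrm (Theta K s *: y) <= c * nrm y * expR (k * s).
  by move=> s0; rewrite nrmZ mulrAC ler_wpM2r ?nrm_ge0// hc.
have H r : r0 <= r -> r <= r0 + e -> has_laplace (fun t => Theta K t *: y) r%:C 0.
  move=> r0r re.
  have := @Theta_laplace _ _ hK _ hbeta E y r%:C (lt_le_trans r00 r0r) (lt_le_trans br0 r0r).
  suff -> : laplace K r%:C = 0 by rewrite mul0r scale0r.
  by apply/eqP/negPn/negP => lr; apply: (hr r).
have /eqP := laplace_eq0_interval r00 cTy Tyb kl e0 H t0.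
by rewrite scaler_eq0 (negbTE y0) orbF => /eqP.
Qed.

(** At a zero r of K~ the pair of transforms is approximated by the pairs at nonzeros r' slightly
    larger than r; closedness of P gives the relation at r, and then the inversion applies. *)
Lemma laplace_relation (P : E -> E -> Prop) f g (B k : R) : closed_relation P ->
    0 < k -> beta <= k -> ucont f -> ucont g ->
    (forall s, 0 <= s -> nrm (f s) <= B * expR (k * s)) ->
    (forall s, 0 <= s -> nrm (g s) <= B * expR (k * s)) ->
    (forall r v w, k < r -> laplace K r%:C != 0 ->
       has_laplace f r%:C v -> has_laplace g r%:C w -> P v w) ->
  forall t, 0 <= t -> P (f t) (g t).
Proof.
move=> hP k0 bk cf cg fB gB hfg t t0.
(* [laplace_neq0_dense] asks for a nonzero vector; in the zero space the claim is P 0 0. *)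
have [[y y0]|/forallNP E0] := pselect (exists y : E, y != 0); last first.
  have {}E0 z : z = 0 :> E by apply/eqP/negPn/negP; exact: E0.
  by rewrite (E0 (f t)) (E0 (g t)); case: hP.
apply: (laplace_inversion hP k0 cf cg fB gB) t0 => r kr.
have [v fv] := @has_laplace_exists _ _ f B k r%:C cf kr fB.
have [w gw] := @has_laplace_exists _ _ g B k r%:C cg kr gB.
exists v, w; split => //; case: (hP) => _ _; apply => e e0.
have [d d0 hd] := laplace_right_continuous fB kr e0.
have [d' d'0 hd'] := laplace_right_continuous gB kr e0.
have m0 : 0 < Num.min d d' by rewrite lt_min d0.
have [r' [rr' r'd K0]] := laplace_neq0_dense y0 (lt_trans k0 kr) (le_lt_trans bk kr) m0.
have kr' := lt_le_trans kr rr'.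
have [v' fv'] := @has_laplace_exists _ _ f B k r'%:C cf kr' fB.
have [w' gw'] := @has_laplace_exists _ _ g B k r'%:C cg kr' gB.
have md : Num.min d d' <= d by rewrite ge_min lexx.
have md' : Num.min d d' <= d' by rewrite ge_min lexx orbT.
exists v', w'; split; first exact: (hfg r').
- by rewrite nrmBC; apply: (hd r') => //; lra.
- by rewrite nrmBC; apply: (hd' r') => //; lra.
Qed.

End Uniqueness.

(** * Subgenerators and resolvents *)

Section Operators.
Context (R : realType) (E : completeNormedModType R[i]).
Implicit Types (T : {linear E -> E}) (A : linop E).

Lemma nrm_le_opnorm T x : continuous T -> nrm (T x) <= opnorm T * nrm x.
Proof.
move=> cT.
(* [sup] dominates its set only once the set is known to be bounded above. *)
have [M [M0 hM]] : exists M : R[i], 0 < M /\ forall x, `|T x| <= M * `|x|.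
  have /linear_boundedP/pinfty_ex_gt0[M M0 hM] := continuous_linear_bounded 0 (cT 0).
  by exists M.
have [->|x0] := eqVneq x 0; first by rewrite linear0 !nrm0 mulr0.
have n0 : 0 < nrm x.
  rewrite lt_neqAle nrm_ge0 andbT eq_sym; apply: contra x0 => /eqP/nrm_eq0 ->.
  exact: eqxx.
rewrite -ler_pdivrMr// mulrC -nrmZr_ge0 ?invr_ge0 ?(ltW n0)// -linearZ/=.
apply: ub_le_sup.
  exists (complex.Re M) => _ [y /= y1 <-]; rewrite -/(nrm (T y)).
  have := hM y; rewrite nrmE => TM.
  have : (nrm (T y))%:C <= M.
    by rewrite (le_trans TM)// ler_piMr// ltW.
  by rewrite lecE/= => /andP[].
exists ((nrm x)^-1%:C *: x) => //=.
by rewrite normrZ !nrmE nrm_real -rmorphM/= ger0_norm ?invr_ge0 ?(ltW n0)// mulVf// gt_eqF.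
Qed.

Lemma closed_relation_linear T : continuous T -> closed_relation (fun x y => y = T x).
Proof.
move=> cT; split=> [|a x _ y _ -> ->|x y h]; first by rewrite linear0.
  by rewrite linearP.
apply/eqP; rewrite -subr_eq0; apply/eqP; apply: nrm_le_small => e e0.
(* The absolute value spares a proof that the supremum is nonnegative. *)
have c0 : 0 < 1 + `|opnorm T| by rewrite ltr_wpDr.
have [x' [_ [-> h1 h2]]] := h _ (divr_gt0 e0 c0).
have -> : y - T x = (y - T x') - T (x - x').
  by rewrite linearB/= opprB addrA subrK.
rewrite (le_trans (nrmB _ _))//.
have h3 : nrm (T (x - x')) <= `|opnorm T| * (e / (1 + `|opnorm T|)).
  rewrite (le_trans (nrm_le_opnorm _ cT))// (le_trans (ler_wpM2r (nrm_ge0 _) (ler_norm _)))//.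
  by rewrite ler_wpM2l.
by rewrite (le_trans (lerD h2 h3))// -[X in X + _]mul1r -mulrDl mulrC divfK//.
Qed.

Lemma linop0 A : A 0 = 0.
Proof.
have := @op_linear _ _ A 1 0 0 (dom_0 A) (dom_0 A).
rewrite !scale1r addr0 => h; apply: (addIr (A 0)); by rewrite add0r.
Qed.

Lemma closed_linop_relation A : closed_linop A ->
  closed_relation (fun x y => dom A x /\ y = A x).
Proof.
move=> cA; split=> [|a x y x' y' [dx ->] [dx' ->]|x y h].
- by split; [exact: dom_0|rewrite linop0].
- by split; [exact: dom_linear|rewrite op_linear].
- apply: (cA (x, y)) => W [[U V] /= [/nbhs_ballP[d /= d0 dU] /nbhs_ballP[d' /= d'0 dV]] UVW].
  move: d0 d'0; rewrite !ltcE/= => /andP[/eqP Id d0] /andP[/eqP Id' d'0].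
  pose e := Num.min (complex.Re d) (complex.Re d') / 2.
  have e0 : 0 < e by rewrite divr_gt0// lt_min d0.
  have [x' [y' [xy' hx hy]]] := h e e0.
  exists (x', y'); split => //; apply: UVW; split => /=.
  + apply: dU; rewrite -ball_normE/= nrmE ltcE/= Id eqxx/= (le_lt_trans hx)//.
    have : Num.min (complex.Re d) (complex.Re d') <= complex.Re d by rewrite ge_min lexx.
    by rewrite /e; lra.
  + apply: dV; rewrite -ball_normE/= nrmE ltcE/= Id' eqxx/= (le_lt_trans hy)//.
    have : Num.min (complex.Re d) (complex.Re d') <= complex.Re d' by rewrite ge_min lexx orbT.
    by rewrite /e; lra.
Qed.

Lemma lambda_sub_inv_eq A l x y : set_inj (dom A) (lambda_sub A l) ->
  dom A x -> lambda_sub A l x = y -> lambda_sub_inv A l y = x.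
Proof.
move=> inj dx xy; rewrite /lambda_sub_inv; apply: xget_unique; first by split.
by move=> z [dz zy]; apply: inj; rewrite ?inE// zy.
Qed.

End Operators.

Section ConvolutedCosine.
Context (R : realType) (E : completeNormedModType R[i]).
Context (A : linop E) (hA : closed_linop A) (C : {linear E -> E}).
Context (CK : R -> {linear E -> E}) (M omega : R).
Hypotheses (hCK : strongly_continuous_family CK) (M0 : 0 < M) (bCK : exp_bound CK M omega).

Lemma ucont_family x : ucont (fun t => CK t x).
Proof. by case: hCK => _ h; exact: ucont_within. Qed.

Lemma nrm_family x (k t : R) : omega <= k -> 0 <= t ->
  nrm (CK t x) <= M * nrm x * expR (k * t).
Proof.
move=> ok t0; have ct : continuous (CK t) by case: hCK => + _; apply.
rewrite (le_trans (nrm_le_opnorm x ct))// mulrAC ler_wpM2r ?nrm_ge0//.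
rewrite (le_trans (bCK t0))// ler_wpM2l ?(ltW M0)// ler_expR.
by rewrite ler_wpM2r.
Qed.

Lemma family_second_primitive x : exists S : R -> E, [/\ ucont S,
  forall t, 0 <= t -> is_RInt (fun s => (t - s)%:C *: CK s x) 0 t (S t),
  forall k, 0 < k -> omega <= k -> forall t, 0 <= t ->
    nrm (S t) <= M * nrm x / k / k * expR (k * t) &
  forall k l v, 0 < k -> omega <= k -> k < complex.Re l ->
    has_laplace (fun t => CK t x) l v -> has_laplace S l ((l ^+ 2)^-1 *: v)].
Proof.
have [S1 fS1 S10] := prim_exists (ucont_family x).
have [S2 SS2 S20] := prim_exists (prim_prim_ucont fS1).
exists S2; split.
- exact: prim_prim_ucont SS2.
- move=> t t0.
  have pt : is_prim (fun=> -1 : R[i]^o) (fun s => (t - s)%:C : R[i]^o).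
    have := @prim_real R (fun s => t - s) (fun=> -1) _ (fun s => cvg_cst _).
    rewrite rmorphN1; apply => s.
    by apply: is_derive_eq; rewrite add0r mul1r.
  (* Partial integration: the derivative -S1 produced by t - s is cancelled by that of S2. This
     primitive is 0 at s = 0 and S2(t) at s = t. *)
  have pS : is_prim (fun s => (t - s)%:C *: CK s x) (fun s => (t - s)%:C *: S1 s + S2 s).
    apply: eq_prim (primD (prim_scale pt fS1) SS2) => s _ //.
    by rewrite scaleN1r addrAC addNr add0r.
  have := prim_is_RInt (lexx _) t0 pS.
  by rewrite subrr scale0r add0r S10 S20 scaler0 addr0 subr0.
- move=> k k0 ok; apply: (prim_exp_bound SS2 S20 k0).
  apply: (prim_exp_bound fS1 S10 k0) => t t0; exact: nrm_family.
- move=> k l v k0 ok kl fv.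
  have fB t : 0 <= t -> _ := @nrm_family x k t ok.
  have := laplace_prim SS2 S20 k0 kl (prim_exp_bound fS1 S10 k0 fB)
    (laplace_prim fS1 S10 k0 kl fB fv).
  by rewrite scalerA -invfM -expr2.
Qed.

End ConvolutedCosine.

(** * The two implications *)

Section Main.
Context (R : realType) (E : completeNormedModType R[i]).
Context (A : linop E) (hA : closed_linop A) (C : {linear E -> E}).
Context (K : R -> R[i]) (hK : L1loc K) (beta : R).
Hypothesis hbeta : forall l : R[i], beta < complex.Re l -> laplace_ex K l.
Context (CK : R -> {linear E -> E}) (M omega : R).
Hypotheses (M0 : 0 < M) (omega0 : 0 <= omega).
Hypotheses (hCK : strongly_continuous_family CK) (bCK : exp_bound CK M omega).

Lemma linop_lin (a : R[i]) x y : dom A x -> dom A y ->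
  dom A (a *: x + y) /\ A (a *: x + y) = a *: A x + A y.
Proof. by move=> dx dy; split; [exact: dom_linear|exact: op_linear]. Qed.

Lemma linopZ (a : R[i]) x : dom A x -> dom A (a *: x) /\ A (a *: x) = a *: A x.
Proof. by move=> dx; have := linop_lin a dx (dom_0 A); rewrite linop0 !addr0. Qed.

Lemma laplace_family_exists x (l : R[i]) : omega < complex.Re l ->
  exists v, has_laplace (fun t => CK t x) l v.
Proof.
move=> ol; apply: (has_laplace_exists (ucont_family hCK x) ol) => t t0.
exact: (nrm_family hCK M0 bCK x (lexx _) t0).
Qed.

Lemma subgenerator_laplace x (l : R[i]) v : omega < complex.Re l -> beta < complex.Re l ->
    (forall t, 0 <= t -> exists v,
        [/\ is_RInt (fun s => (t - s)%:C *: CK s x) 0 t v,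
            dom A v & A v = CK t x - Theta K t *: C x]) ->
    has_laplace (fun t => CK t x) l v ->
  dom A v /\ A v = l ^+ 2 *: v - (l * laplace K l) *: C x.
Proof.
move=> ol bl hS fv; have l0 := le_lt_trans omega0 ol.
have ln0 : l != 0 by apply: contraTneq l0 => ->; rewrite ltxx.
have [S [_ SI _ SL]] := family_second_primitive hCK M0 bCK x.
(* A growth rate strictly between omega and Re l. It is positive even for omega = 0, as required by
   the bounds on primitives, which divide by k. *)
have o0 := omega0; pose k := (omega + complex.Re l) / 2.
have k0 : 0 < k by rewrite /k; lra.
have ok : omega <= k by rewrite /k; lra.
have kl : k < complex.Re l by rewrite /k; lra.
have Sv := SL k l v k0 ok kl fv.
have gv := improper_intB fv (Theta_laplace hK hbeta (C x) l0 bl).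
have [|dv Av] := improper_int_closed_relation (closed_linop_relation hA) _ Sv gv.
  move=> t t0; have [w [wI dw Aw]] := hS t t0.
  have -> : S t = w by apply: (is_RInt_unique t0 (SI t t0) wI).
  rewrite -scalerBr -Aw; have [dk ->] := linopZ (exp_ker l t) dw.
  by split.
have l2 : l ^+ 2 != 0 by rewrite expf_neq0.
have [dv2 Av2] := linopZ (l ^+ 2) dv.
rewrite scalerA mulfV// scale1r in dv2 Av2; split => //.
rewrite Av2 -Av scalerBr scalerA; congr (_ - _ *: _).
by field.
Qed.

(** Restates (2) as an equation for w = (l^2 - A)^-1 Cx, which (1) provides, so that the default
    value of [lambda_sub_inv] no longer matters. *)
Lemma laplace_of_resolvent_formula x (l : R[i]) v :
    Num.max omega beta < complex.Re l ->
    resolvent_inclusion K C A (Num.max omega beta) ->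
    resolvent_formula K C A CK (Num.max omega beta) -> laplace K l != 0 ->
    has_laplace (fun t => CK t x) l v ->
  exists w, [/\ dom A w, l ^+ 2 *: w - A w = C x & v = (l * laplace K l) *: w].
Proof.
move=> ml hincl hform Kl fv.
have [hr hi] : rhoC C A (l ^+ 2) by apply: hincl; exists l.
have [|w dw wx] := hr (C x); first by exists x.
exists w; split => //.
have [v' [fv' hv']] := hform x l ml Kl.
have cf : ucont (fun t => exp_ker l t *: CK t x).
  exact: ucont_scale (ucont_ker l) (ucont_family hCK x).
have -> : v = v' by apply: improper_int_unique fv (is_RInt_oo_improper_int cf fv').
move: hv'; rewrite (lambda_sub_inv_eq hi dw wx) => h.
by rewrite mulrC -scalerA h scalerA mulfV// scale1r.
Qed.

Lemma resolvent_of_subgenerator : injective C->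
    subgenerator_of_convoluted_cosine K C A CK ->
  resolvent_inclusion K C A (Num.max omega beta) /\
  resolvent_formula K C A CK (Num.max omega beta).
Proof.
move=> Cinj [_ CA _ hS].
have core (l : R[i]) : Num.max omega beta < complex.Re l -> laplace K l != 0 ->
    set_inj (dom A) (lambda_sub A (l ^+ 2)) /\
    forall x, exists v, has_laplace (fun t => CK t x) l v /\
      (dom A ((l * laplace K l)^-1 *: v) /\
       lambda_sub A (l ^+ 2) ((l * laplace K l)^-1 *: v) = C x).
  rewrite gt_max => /andP[ol bl] Kl; have l0 := le_lt_trans omega0 ol.
  have ln0 : l != 0 by apply: contraTneq l0 => ->; rewrite ltxx.
  have lK0 : l * laplace K l != 0 by rewrite mulf_neq0.
  split; last first.
    move=> x; have [v fv] := laplace_family_exists x ol.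
    have [dv Av] := subgenerator_laplace ol bl (fun t t0 => hS x t t0) fv.
    exists v; split => //; have [dw Aw] := linopZ (l * laplace K l)^-1 dv.
    split=> //; rewrite /lambda_sub Aw Av scalerBr !scalerA mulVf// scale1r.
    by rewrite [_^-1 * _]mulrC opprB addrC subrK.
  move=> x y; rewrite !inE => dx dy xy.
  (* Injectivity: z = x - y satisfies A z = l^2 z, and C z = 0 is to be shown. *)
  have [dz Az] := linop_lin (-1) dy dx.
  set z := -1 *: y + x in dz Az.
  have {}Az : A z = l ^+ 2 *: z.
    move: xy; rewrite /lambda_sub Az /z scalerDr scalerA mulrN1 !scaleNr scale1r => xy.
    apply/eqP; rewrite -subr_eq0; apply/eqP.
    have -> : - A y + A x - (- (l ^+ 2 *: y) + l ^+ 2 *: x) =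
      (l ^+ 2 *: y - A y) - (l ^+ 2 *: x - A x).
      by vector_identity (R[i]) [:: A x; A y; x; y]; ring.
    by rewrite xy subrr.
  have [v fv] := laplace_family_exists z ol.
  have [dv Av] := subgenerator_laplace ol bl (fun t t0 => hS z t t0) fv.
  (* C_K(t) commutes with A, so A C_K(t)z = l^2 C_K(t)z and the transform satisfies A v = l^2 v.
     Against A v = l^2 v - l K~(l) Cz this leaves Cz = 0. *)
  have [|_ Av'] := improper_int_closed_relation (closed_linop_relation hA) _ fv
    (improper_intZ (l ^+ 2) fv).
    move=> t t0; have [dt At] := CA t t0 z dz.
    have [dk ->] := linopZ (exp_ker l t) dt; split => //.
    by rewrite -At Az (linearZZ (CK t)) !scalerA mulrC.
  have Cz : C z = C 0.
    move: Av; rewrite -Av' linear0 => /eqP; rewrite eq_sym subr_eq addrC -subr_eq subrr.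
    by rewrite eq_sym scaler_eq0 (negbTE lK0) => /eqP.
  have /eqP := Cinj _ _ Cz.
  by rewrite /z scaleN1r addrC subr_eq0 => /eqP.
split=> [_ [l [ml Kl] <-]|x l ml Kl].
  have [hi hr] := core l ml Kl; split => // _ [x _ <-].
  by have [v [_ [dw wx]]] := hr x; exists ((l * laplace K l)^-1 *: v).
have [hi hr] := core l ml Kl; have [v [fv [dw wx]]] := hr x.
have l0 : l != 0.
  apply: contraTneq ml => ->; rewrite /= -leNgt le_max omega0//.
exists v; split; first exact: improper_int_is_RInt_oo fv.
by rewrite (lambda_sub_inv_eq hi dw wx) scalerA invfM mulrA mulfV// mul1r.
Qed.

Lemma subgenerator_of_resolvent : commutes_into C A -> continuous C -> ~ L1loc_zero K ->
    resolvent_inclusion K C A (Num.max omega beta) ->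
    resolvent_formula K C A CK (Num.max omega beta) ->
  subgenerator_of_convoluted_cosine K C A CK.
Proof.
move=> hCA cC K0 hincl hform.
(* The inversion uses large real l only, so the margin 1 is harmless; it makes k positive and every
   r > k admissible in (1) and (2). *)
pose k := Num.max omega beta + 1.
have ok : omega <= k by rewrite /k (@le_trans _ _ (Num.max omega beta)) ?le_max ?lexx ?lerDl.
have bk : beta < k.
  by rewrite /k (@le_lt_trans _ _ (Num.max omega beta)) ?le_max ?lexx ?orbT ?ltrDl.
have k0 : 0 < k.
  by rewrite /k ltr_wpDl// le_max omega0.
have ml (r : R) : k < r -> Num.max omega beta < complex.Re r%:C by rewrite /k/=; lra.
have rn0 (r : R) : k < r -> (r%:C : R[i]) != 0.
  by move=> kr; rewrite -[0]/(0%:C) (inj_eq (@complexI _)) gt_eqF// (lt_trans k0).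
have res x (r : R) v : k < r -> laplace K r%:C != 0 ->
  has_laplace (fun t => CK t x) r%:C v -> _ :=
  fun kr Kr => @laplace_of_resolvent_formula x r%:C v (ml r kr) hincl hform Kr.
have inj (r : R) : k < r -> laplace K r%:C != 0 ->
    set_inj (dom A) (lambda_sub A (r%:C ^+ 2)).
  move=> kr Kr; have [//] : rhoC C A (r%:C ^+ 2).
  by apply: hincl; exists r%:C => //; split => //; exact: ml.
have bnd x y : exists B, (forall t, 0 <= t -> nrm (CK t x) <= B * expR (k * t)) /\
    (forall t, 0 <= t -> nrm (CK t y) <= B * expR (k * t)).
  exists (M * nrm x + M * nrm y); split => t t0.
    rewrite (le_trans (nrm_family hCK M0 bCK x ok t0))// ler_wpM2r ?expR_ge0//.
    by rewrite lerDl mulr_ge0 ?nrm_ge0// ltW.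
  rewrite (le_trans (nrm_family hCK M0 bCK y ok t0))// ler_wpM2r ?expR_ge0//.
  by rewrite lerDr mulr_ge0 ?nrm_ge0// ltW.
split => //.
- move=> t t0 x dx.
  have [B [fB gB]] := bnd x (A x).
  have [] : dom A (CK t x) /\ CK t (A x) = A (CK t x); last by [].
  apply: (laplace_relation hK K0 hbeta (closed_linop_relation hA) k0 (ltW bk)
    (ucont_family hCK x) (ucont_family hCK (A x)) fB gB _ t0) => r v v' kr Kr fv gv.
  have [w [dw wx ->]] := res x r v kr Kr fv.
  have [w' [dw' wx' ->]] := res (A x) r v' kr Kr gv.
  have [dCx CAx] := hCA x dx.
  have AwE : A w = r%:C ^+ 2 *: w + -1 *: C x.
    by rewrite -wx scaleN1r opprB addrC subrK.
  (* A w = l^2 w - Cx lies in D(A) because Cx does. Then (l^2 - A)Aw = ACx = CAx, so Aw solves the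
     equation that determines w'. *)
  have [dAw AAw] : dom A (A w) /\ A (A w) = r%:C ^+ 2 *: A w + -1 *: A (C x).
    have [d1 e1] := linopZ (-1) dCx; have [d2 e2] := linop_lin (r%:C ^+ 2) dw d1.
    by rewrite -AwE in d2 e2; rewrite -e1; split.
  have w'E : w' = A w.
    apply: (inj r kr Kr); rewrite ?inE//.
    by rewrite /lambda_sub wx' AAw CAx scaleN1r opprD opprK addNKr.
  have [dv ->] := linopZ (r%:C * laplace K r%:C) dw.
  by split => //; rewrite w'E.
- move=> t t0 x.
  have [B [fB gB]] := bnd x (C x).
  apply: (laplace_relation hK K0 hbeta (closed_relation_linear cC) k0 (ltW bk)
    (ucont_family hCK x) (ucont_family hCK (C x)) fB gB _ t0) => r v v' kr Kr fv gv.
  have [w [dw wx ->]] := res x r v kr Kr fv.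
  have [w' [dw' wx' ->]] := res (C x) r v' kr Kr gv.
  have [dCw CAw] := hCA w dw.
  (* Both solve (l^2 - A)z = CCx, the right one because C commutes with A on D(A). *)
  have -> : w' = C w.
    apply: (inj r kr Kr); rewrite ?inE//.
    by rewrite /lambda_sub wx' -CAw -wx (linearB C) (linearZZ C).
  by rewrite linearZ.
- move=> x t t0.
  have [S [cS SI SB SL]] := family_second_primitive hCK M0 bCK x.
  have [c hc] := Theta_exp_bound hK hbeta k0 bk.
  pose g s := CK s x - Theta K s *: C x.
  have cg : ucont g.
    apply: ucontB; first exact: (ucont_family hCK).
    by apply: ucont_scale; [exact: Theta_ucont|exact: ucont_cst].
  have c0 := exp_bound_ge0 hc.
  pose B := M * nrm x / k / k + (M * nrm x + c * nrm (C x)).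
  have Mx : 0 <= M * nrm x by rewrite mulr_ge0 ?nrm_ge0// ltW.
  have cx : 0 <= c * nrm (C x) by rewrite mulr_ge0 ?nrm_ge0.
  have fB s : 0 <= s -> nrm (S s) <= B * expR (k * s).
    move=> s0; rewrite (le_trans (SB k k0 ok s s0))// ler_wpM2r ?expR_ge0//.
    by rewrite /B lerDl addr_ge0.
  have gB s : 0 <= s -> nrm (g s) <= B * expR (k * s).
    move=> s0; rewrite (le_trans (nrmB _ _))//.
    apply: (@le_trans _ _ ((M * nrm x + c * nrm (C x)) * expR (k * s))).
      rewrite mulrDl lerD ?(nrm_family hCK M0 bCK)//.
      by rewrite nrmZ mulrAC ler_wpM2r ?nrm_ge0// hc.
    by rewrite ler_wpM2r ?expR_ge0// lerDr !divr_ge0// ltW.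
  exists (S t).
  have [] : dom A (S t) /\ g t = A (S t); last by move=> dS gS; split => //; exact: SI.
  apply: (laplace_relation hK K0 hbeta (closed_linop_relation hA) k0 (ltW bk)
    cS cg fB gB _ t0) => r v v' kr Kr Sv gv'.
  have or : omega < complex.Re r%:C by rewrite /= (le_lt_trans ok).
  have br : beta < complex.Re r%:C by rewrite /= (lt_trans bk).
  have r0 : 0 < complex.Re r%:C by rewrite /= (lt_trans k0).
  have [u fu] := laplace_family_exists x or.
  have -> : v = (r%:C ^+ 2)^-1 *: u by exact: (improper_int_unique Sv (SL k r%:C u k0 ok kr fu)).
  have gu := improper_intB fu (Theta_laplace hK hbeta (C x) r0 br).
  have -> : v' = u - (laplace K r%:C / r%:C) *: C x.
    apply: (improper_int_unique gv'); apply: eq_improper_int gu => s _.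
    by rewrite -scalerBr.
  have [w [dw wx ->]] := res x r u kr Kr fu.
  rewrite scalerA.
  have [dv ->] := linopZ ((r%:C ^+ 2)^-1 * (r%:C * laplace K r%:C)) dw.
  split => //.
  (* With u = l K~(l) w the transform of S is (K~(l) / l) w, and A maps it to l K~(l) w - (K~(l) /
     l) Cx, the transform of g. *)
  have -> : A w = r%:C ^+ 2 *: w - C x by rewrite -wx opprB addrC subrK.
  vector_identity (R[i]) [:: w; C x].
    by field; exact: rn0.
  by field; exact: rn0.
Qed.

End Main.

Theorem theorem6 (R : realType) (E : completeNormedModType R[i])
  (A : linop E) (hA : closed_linop A)
  (C : {linear E -> E}) (hC : continuous C) (Cinj : injective C)
  (hCA : commutes_into C A)
  (K : R -> R[i]) (hK : L1loc K) (K_neq0 : ~ L1loc_zero K)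
  (beta : R)
  (hbeta : forall lambda : R[i], beta < complex.Re lambda ->
     laplace_ex K lambda) :
  (forall (CK : R -> {linear E -> E}) (M omega : R),
     0 < M -> 0 <= omega ->
     subgenerator_of_convoluted_cosine K C A CK ->
     exp_bound CK M omega ->
     let omega1 := Num.max omega beta in
     resolvent_inclusion K C A omega1 /\
     resolvent_formula K C A CK omega1) /\
  (forall (CK : R -> {linear E -> E}) (M omega : R),
     0 < M -> 0 <= omega ->
     strongly_continuous_family CK ->
     exp_bound CK M omega ->
     let omega1 := Num.max omega beta in
     resolvent_inclusion K C A omega1 ->
     resolvent_formula K C A CK omega1 ->
     subgenerator_of_convoluted_cosine K C A CK /\
     exponentially_bounded CK).
Proof.
split=> [CK M omega M0 o0 hsub hb /=|CK M omega M0 o0 hs hb /= hincl hform].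
  have [hs _ _ _] := hsub.
  exact: (resolvent_of_subgenerator hA hK hbeta M0 o0 hs hb Cinj hsub).
split; last by exists M, omega.
exact: (subgenerator_of_resolvent hA hK hbeta M0 o0 hs hb hCA hC K_neq0 hincl hform).
Qed.
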